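(* Assume $\mathsf{IIA}$. Then every countable sequential topological group is either metrizable or a $k_\omega$-space.
   Context: All topological spaces and groups are $T_1$ and completely regular. A sequence converging to $x$ is identified with an infinite set $C$ such that $C\setminus U$ is finite for every neighborhood $U$ of $x$ (written $C\to x$). $A\subseteq^* B$ means $A\setminus B$ is finite. A space $X$ is sequential if for every non-closed $A\subseteq X$ there is a sequence $C\subseteq A$ with $C\to x$ for some $x\notin A$. A space $X$ is a $k_\omega$-space if there is a countable family $\mathcal K$ of compact subspaces of $X$ such that $U\subseteq X$ is open in $X$ if and only if $U\cap K$ is relatively open in $K$ for every $K\in\mathcal K$. An ideal on a set $X$ is a family of subsets of $X$ closed under subsets and finite unions; ideals are assumed to contain all finite sets (this convention does not apply to the ideals $\mathcal I_x$ defined below). $\mathcal I^+=\mathcal P(X)\setminus\mathcal I$. An ideal $\mathcal I$ on a group $\mathbb G$ is invariant if $g\cdot I$, $I\cdot g$ and $I^{-1}$ are in $\mathcal I$ for all $I\in\mathcal I$, $g\in\mathbb G$. An ideal $\mathcal I$ on $X$ is $\omega$-hitting if for every countable family $\mathcal Y$ of infinite subsets of $X$ there is $I\in\mathcal I$ with $Y\cap I$ infinite for every $Y\in\mathcal Y$. An ideal $\mathcal I$ is tame if for every $Y\in\mathcal I^+$, every $f:Y\to\omega$ and every $\omega$-hitting ideal $\mathcal J$ on $\omega$ there is $J\in\mathcal J$ with $f^{-1}[J]\notin\mathcal I$. An ideal $\mathcal I$ on a topological group $\mathbb G$ is weakly closed if for every $A\subseteq\mathbb G$ and every (infinite) sequence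 $C\subseteq\mathbb G$ converging to $1_{\mathbb G}$: $A\in\mathcal I$ if and only if $A\cup\{x: C\cdot x\subseteq^* A\}\in\mathcal I$. For a point $x$ of a space $X$ let $\mathcal I_x=\{A\subseteq X: x\notin\overline A\}$. A set $Y\subseteq X$ is entangled if $\mathcal I_x\restriction Y=\{A\subseteq Y:x\notin\overline A\}$ is $\omega$-hitting (on $Y$) for every $x\in X$. A space is groomed if it does not contain a dense entangled set. $\mathsf{IIA}$ (the Invariant Ideal Axiom) is the statement: for every countable groomed topological group $\mathbb G$ and every tame, weakly closed, invariant ideal $\mathcal I\subseteq\mathcal P(\mathbb G)$ one of the following holds: (1) there is a countable $\mathcal S\subseteq\mathcal I$ such that for every infinite sequence $C$ convergent in $\mathbb G$ there is $I\in\mathcal S$ with $C\cap I$ infinite; (2) there is a countable $\mathcal H\subseteq\mathcal I^+$ such that for every non-empty open $U\subseteq\mathbb G$ there is $H\in\mathcal H$ with $H\setminus U\in\mathcal I$. *)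

(* Defs.v *)
From HB Require Import structures.
From mathcomp Require Import all_boot all_order all_algebra.
From mathcomp Require Import all_classical all_reals all_analysis.

Set Implicit Arguments.
Unset Strict Implicit.
Unset Printing Implicit Defensive.

Import Order.TTheory GRing.Theory Num.Theory.
Import numFieldNormedType.Exports.

Local Open Scope classical_set_scope.

HB.mixin Record Group_Topological_isTopologicalGroup G
    of Group G & Topological G := {
  mulg_continuous : continuous (fun p : G * G => (p.1 * p.2)%g);
  invg_continuous : continuous (fun x : G => (x^-1)%g)
}.

#[short(type="topologicalGroupType")]
HB.structure Definition TopologicalGroup :=
  {G of Group_Topological_isTopologicalGroup G
      & Group G & Topological G}.

Definition tychonoff_space (T : topologicalType) : Prop :=
  accessible_space T /\ completely_regular_space T.

(* A convergent sequence is identified with its range, so C is required to be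
   infinite; the limit x may or may not belong to C. *)
Definition converges_to (T : topologicalType) (C : set T) (x : T) : Prop :=
  infinite_set C /\ forall U : set T, nbhs x U -> finite_set (C `\` U).

Definition almost_subset (T : Type) (A B : set T) : Prop :=
  finite_set (A `\` B).

Definition sequential_space (T : topologicalType) : Prop :=
  forall A : set T, ~ closed A ->
    exists (C : set T) (x : T), [/\ C `<=` A, converges_to C x & ~ A x].

Definition k_omega_space (T : topologicalType) : Prop :=
  exists K : set (set T),
    [/\ countable K,
        (forall B, K B -> compact B)
      & forall U : set T,
          open U <-> forall B, K B -> open (U `&` B : set (subspace B))].

Definition metrizable_space (R : realType) (T : topologicalType) : Prop :=
  exists d : T -> T -> R,
    [/\ (forall x y, d x y = 0%R <-> x = y),
        (forall x y, d x y = d y x),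
        (forall x y z, (d x z <= d x y + d y z)%R)
      & forall (x : T) (U : set T),
          nbhs x U <->
          exists e : R, (0 < e)%R /\ [set y | (d x y < e)%R] `<=` U].

(* The whole powerset is allowed as an ideal. *)
Definition is_ideal (X : Type) (I : set (set X)) : Prop :=
  [/\ (forall A B, A `<=` B -> I B -> I A),
      (forall A B, I A -> I B -> I (A `|` B))
    & (forall A, finite_set A -> I A)].

Definition positive_sets (X : Type) (I : set (set X)) : set (set X) := ~` I.

(* "I is omega-hitting on D", for a family I of subsets of D. *)
Definition omega_hitting (X : Type) (D : set X) (I : set (set X)) : Prop :=
  forall F : set (set X), countable F ->
    (forall Y, F Y -> Y `<=` D /\ infinite_set Y) ->
    exists2 A, I A & forall Y, F Y -> infinite_set (Y `&` A).

(* A function f : Y -> omega is represented by the restriction to Y of a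
   function on X, so its preimage of B is Y `&` f @^-1` B. *)
Definition tame (X : Type) (I : set (set X)) : Prop :=
  forall (Y : set X), positive_sets I Y ->
  forall (f : X -> nat) (J : set (set nat)),
    is_ideal J -> omega_hitting [set: nat] J ->
    exists2 B, J B & ~ I (Y `&` f @^-1` B).

Definition invariant_ideal (G : groupType) (I : set (set G)) : Prop :=
  forall (A : set G), I A ->
    (forall g : G, I [set (g * a)%g | a in A] /\ I [set (a * g)%g | a in A])
    /\ I [set (a^-1)%g | a in A].

Definition weakly_closed (G : topologicalGroupType) (I : set (set G)) : Prop :=
  forall A C : set G, converges_to C 1%g ->
    I A <->
    I (A `|` [set x | almost_subset [set (c * x)%g | c in C] A]).

Definition local_trace (T : topologicalType) (x : T) (Y : set T) :
    set (set T) :=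
  [set A | A `<=` Y /\ ~ closure A x].

Definition entangled (T : topologicalType) (Y : set T) : Prop :=
  forall x : T, omega_hitting Y (local_trace x Y).

Definition groomed (T : topologicalType) : Prop :=
  ~ exists Y : set T, dense Y /\ entangled Y.

Definition IIA : Prop :=
  forall G : topologicalGroupType,
    tychonoff_space G -> countable [set: G] -> groomed G ->
  forall I : set (set G),
    is_ideal I -> tame I -> weakly_closed I -> invariant_ideal I ->
    (exists S : set (set G),
       [/\ countable S, S `<=` I
         & forall C : set G, (exists x : G, converges_to C x) ->
             exists2 A, S A & infinite_set (C `&` A)])
    \/
    (exists H : set (set G),
       [/\ countable H, H `<=` positive_sets I
         & forall U : set G, open U -> U !=set0 ->
             exists2 A, H A & I (A `\` U)]).

(* Main.v *)
Require Import Defs.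
From mathcomp Require Import all_boot all_order all_algebra.
From mathcomp Require Import all_classical all_reals all_analysis.

Set Implicit Arguments.
Unset Strict Implicit.
Unset Printing Implicit Defensive.

Import Order.TTheory GRing.Theory Num.Theory.

Local Open Scope classical_set_scope.

(** Let G be countable, sequential and not discrete; then G is groomed.

    If G has Arhangel'skii's property alpha_4 at the identity, G is Frechet and
    IIA applies to the nowhere dense sets: alternative (1) contradicts alpha_4,
    and (2) yields a countable base at the identity, hence metrizability.

    Otherwise there are sequences s_n -> 1 (a fan) such that every set meeting
    each of them in a finite set is closed.  IIA for the relatively compact
    sets gives either k_omega, or countably many sequences d_m without cluster
    points such that every neighbourhood of 1 contains almost all of some d_m.
    The last case is refuted by a further ideal.  A set B is tubular around a
    sequence d without cluster points if, for every finite word n_1 ... n_q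
    (over the fan and its conjugates), there are infinitely many k, infinitely
    many l_1, ..., infinitely many l_q with s_{n_q,l_q} ... s_{n_1,l_1} d_k in
    B.  The sets whose closure is not tubular around any d form an ideal, for
    the same reason as the nowhere dense sets; it is tame because meeting
    countably many suitable infinite sets is enough to remain tubular around a
    given d.  Under (1), each d_m can be moved,
    by elements of G tending to 1, off the first m members of the countable
    family; the union of the resulting sequences is closed and yet accumulates
    at 1.  Under (2), the members H of the countable family are tubular around
    sequences which are eventually close to U, and a neighbourhood U of 1
    avoiding a fast growing part of the fan leaves H \ U tubular. *)

(** * Frequent occurrence and sequences without cluster points *)

Definition frequently (P : nat -> Prop) : Prop :=
  forall N, exists2 k, (N <= k)%N & P k.

Lemma frequentlyS (P Q : nat -> Prop) :
  (forall k, P k -> Q k) -> frequently P -> frequently Q.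
Proof. by move=> PQ fP N; have [k Nk /PQ] := fP N; exists k. Qed.

Lemma frequently_near (P Q : nat -> Prop) : frequently P ->
  (\forall k \near \oo, Q k) -> frequently (fun k => P k /\ Q k).
Proof.
move=> fP [M _ QM] N; have [k Nk Pk] := fP (maxn N M).
by move: Nk; rewrite geq_max => /andP[Nk Mk]; exists k => //; split=> //; apply: QM.
Qed.

Lemma not_frequently (P : nat -> Prop) :
  ~ frequently P -> \forall k \near \oo, ~ P k.
Proof.
move=> /existsNP[N nN]; exists N => // k /= Nk Pk.
by apply: nN; exists k.
Qed.

Lemma frequently_or (P Q : nat -> Prop) :
  frequently (fun k => P k \/ Q k) -> frequently P \/ frequently Q.
Proof.
move=> fPQ; apply: contrapT => /not_orP[/not_frequently nP /not_frequently nQ].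
have [k _ [[]]] := frequently_near fPQ (filterI nP nQ) 0.
  by move=> Pk []. by move=> Qk [].
Qed.

Lemma frequently_true (P : nat -> Prop) : (forall k, P k) -> frequently P.
Proof. by move=> h N; exists N. Qed.

Lemma infinite_injection (T : Type) (A : set T) : infinite_set A ->
  exists2 c : nat -> T, injective c & forall i, A (c i).
Proof.
move=> /infiniteP/card_leP[f].
exists (fun i => set_val (f (to_setT i))); last by move=> i; exact: set_valP.
move=> i j /val_inj /(@inj _ _ _ f); rewrite !inE => /(_ I I) /(congr1 val).
by [].
Qed.

Lemma finite_nat_near (A : set nat) : finite_set A ->
  \forall k \near \oo, ~ A k.
Proof.
move=> /finite_seqP[s ->]; exists (\max_(i <- s) i).+1 => // k /= sk ks.
by move: sk; rewrite ltnNge (leq_bigmax_seq k).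
Qed.

Lemma injective_tends (T : Type) (c : nat -> T) (F : set T) : injective c ->
  finite_set F -> \forall k \near \oo, ~ F (c k).
Proof.
move=> ic fF; apply: (@finite_nat_near (c @^-1` F)).
by apply: finite_preimage => // i j _ _; apply: ic.
Qed.

Lemma infinite_frequently (A : set nat) : infinite_set A <-> frequently A.
Proof.
split=> [iA|fA /finite_nat_near nA].
  apply: contrapT => /not_frequently[N _ nN]; apply: iA.
  apply: sub_finite_set (finite_II N) => k Ak /=; rewrite ltnNge; apply/negP => Nk.
  exact: (nN k).
by have [k _ []] := frequently_near fA nA 0.
Qed.

Lemma countable_enum (T : Type) (S : set T) (x0 : T) : countable S ->
  exists2 u : nat -> T, (forall n, S (u n) \/ u n = x0) &
    (forall x, S x -> exists n, u n = x).
Proof.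
move=> /countable_injP[f injf].
have [u hu] : {u : nat -> T & forall n,
    (S (u n) /\ f (u n) = n) \/ ((forall x, S x -> f x <> n) /\ u n = x0)}.
  apply: (@choice _ _ (fun n y => (S y /\ f y = n) \/
      ((forall x, S x -> f x <> n) /\ y = x0))) => n.
  have [[x Sx fx]|nx] := pselect (exists2 x, S x & f x = n).
    by exists x; left.
  by exists x0; right; split=> // x Sx fx; apply: nx; exists x.
exists u => [n|x Sx]; first by have [[]|[]] := hu n; [left|right].
exists (f x); have [[Su fu]|[nx _]] := hu (f x); last by have := nx _ Sx.
by apply: injf => //; rewrite inE.
Qed.

Definition locally_finite_seq (T : topologicalType) (d : nat -> T) : Prop :=
  forall p : T, exists2 U, nbhs p U & \forall k \near \oo, ~ U (d k).

Definition locally_finite_sets (T : topologicalType) (P : nat -> set T) : Prop :=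
  forall p : T, exists2 U, nbhs p U &
    \forall k \near \oo, forall y, U y -> ~ P k y.

Section Sequences.
Context (T : topologicalType).

Lemma converges_to_seq (C : set T) (x : T) : converges_to C x ->
  exists c : nat -> T, [/\ injective c, (forall i, C (c i)) & c @ \oo --> x].
Proof.
move=> [infC Cx]; have [c injc Cc] := infinite_injection infC.
exists c; split => // U xU.
apply: filterS (injective_tends injc (Cx U xU)) => k /= nCU.
by apply: contrapT => nU; apply: nCU.
Qed.

Lemma closure_frequently (c : nat -> T) (x : T) (A : set T) : c @ \oo --> x ->
  frequently (fun k => A (c k)) -> closure A x.
Proof.
move=> cx fA U xU; have [k _ [Ak Uk]] := frequently_near fA (cx U xU) 0.
by exists (c k).
Qed.

Lemma locally_finite_not_converges (d : nat -> T) (C : set T) (x : T) :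
  locally_finite_seq d -> (forall y, C y -> exists k, y = d k) ->
  ~ converges_to C x.
Proof.
move=> lfd Cd [infC Cx]; have [U xU [N _ nU]] := lfd x; apply: infC.
apply: (@sub_finite_set _ _ ((C `\` U) `|` (d @` `I_N))); last first.
  by rewrite finite_setU; split; [exact: Cx|exact/finite_image/finite_II].
move=> y Cy; have [Uy|nUy] := pselect (U y); [right|by left].
have [k yd] := Cd y Cy; exists k => //=; rewrite ltnNge; apply/negP => Nk.
by apply: (nU k) => //; rewrite -yd.
Qed.

Lemma locally_finite_subordinate (P : nat -> set T) (d : nat -> T) :
  locally_finite_sets P -> (forall i, exists2 k, (i <= k)%N & P k (d i)) ->
  locally_finite_seq d.
Proof.
move=> lfP Pd p; have [U pU [N _ nU]] := lfP p; exists U => //.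
exists N => // i /= Ni Ui; have [k ik Pk] := Pd i.
by apply: (nU k _ (d i)) => //=; apply: leq_trans ik.
Qed.

Lemma subseq_locally_finite (d : nat -> T) (k : nat -> nat) :
  locally_finite_seq d -> (forall i, i <= k i)%N ->
  locally_finite_seq (d \o k).
Proof.
move=> lfd ik p; have [U pU [N _ nU]] := lfd p; exists U => //.
by exists N => // i /= Ni; apply: nU => /=; apply: leq_trans (ik i).
Qed.

Lemma regular_nbhs (x : T) (U : set T) : regular_space T -> nbhs x U ->
  exists2 V, nbhs x V & closure V `<=` U.
Proof. by move=> /(_ x U) h /h [V]; exists V. Qed.

Lemma filter_forall_leq (F : set_system T) {FF : Filter F} (n : nat)
    (Q : nat -> Prop) (B : nat -> set T) : (forall i, Q i -> F (B i)) ->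
  F [set y | forall i, (i <= n)%N -> Q i -> B i y].
Proof.
move=> QB; have h i : F [set y | Q i -> B i y].
  have [Qi|nQi] := pselect (Q i); first by apply: filterS (QB _ Qi) => y By _.
  by apply: filterS filterT => y _ /nQi.
elim: n => [|n IH].
  by apply: filterS (h 0) => y h0 i; rewrite leqn0 => /eqP->.
apply: filterS (filterI (h n.+1) IH) => y /= [h1 h2] i.
by rewrite leq_eqVlt => /predU1P[->//|]; rewrite ltnS; apply: h2.
Qed.

End Sequences.

Section CountableRegular.
Context (T : topologicalType) (hreg : regular_space T) (g : nat -> T)
        (hg : forall x, exists n, g n = x).

(** Each [closure (A i)] contains [d k] for finitely many [k] only, and the k-th open set avoids
    those of [closure (A 0)], ..., [closure (A k)] that miss [d k]. *)
Lemma locally_finite_expansion (d : nat -> T) : locally_finite_seq d ->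
  exists P : nat -> set T, [/\ (forall k, open (P k)), (forall k, P k (d k))
    & locally_finite_sets P].
Proof.
move=> lfd.
have [A hA] : {A : nat -> set T & forall i, nbhs (g i) (A i) /\
    \forall k \near \oo, ~ closure (A i) (d k)}.
  apply: (@choice _ _ (fun i B => nbhs (g i) B /\
    \forall k \near \oo, ~ closure B (d k))) => i.
  have [U gU nU] := lfd (g i); have [V gV VU] := regular_nbhs hreg gU.
  by exists V; split => //; apply: filterS nU => k nUk /VU.
pose P0 k := [set y | forall i, (i <= k)%N -> ~ closure (A i) (d k) ->
  ~ closure (A i) y].
exists (fun k => (P0 k)^°); split => [k|k|p]; first exact: open_interior.
  apply: (@filter_forall_leq _ (nbhs (d k)) _ k (fun i => ~ closure (A i) (d k))
    (fun i => ~` closure (A i))) => i nA.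
  by apply: open_nbhs_nbhs; split => //; apply: closed_openC; exact: closed_closure.
have [i <-] := hg p; have [gA [N _ nA]] := hA i; exists (A i) => //.
exists (maxn N i) => // k /=; rewrite geq_max => /andP[Nk ik] y Ay.
by move/interior_subset => /(_ i ik (nA _ Nk)); apply; apply: subset_closure.
Qed.

End CountableRegular.

(** * Tubular sets *)

Lemma frequent_enum (X : countType) (x0 : X) :
  exists tau : nat -> X, forall x, frequently (fun j => tau j = x).
Proof.
exists (fun j => (odflt (x0, 0) (unpickle j)).1) => x N.
have inj : injective (fun m : nat => pickle (x, m)).
  by move=> m m' /(pcan_inj pickleK) [].
have [M _ /(_ M (leqnn M)) /= h] := injective_tends inj (finite_II N).
exists (pickle (x, M)); first by rewrite leqNgt; apply/negP.
by rewrite pickleK.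
Qed.

Lemma locally_finite_finite (T : topologicalType) (d : nat -> T) (A : set T) :
  locally_finite_seq d -> finite_set A -> \forall k \near \oo, ~ A (d k).
Proof.
move=> lfd /finite_seqP[s ->]; elim: s => [|x s IH].
  by apply: filterS filterT.
have [U xU nU] := lfd x; apply: filterS (filterI nU IH) => k [nUk ns].
rewrite /= inE => /orP[/eqP dx|]; last exact: ns.
by apply: nUk; rewrite dx; apply: nbhs_singleton.
Qed.

(** * Neighbourhoods and translations in a topological group *)

Section Group.
Context (G : topologicalGroupType).
Implicit Types (x y g : G) (U V : set G).

Lemma nbhs_mulg x y U : nbhs (x * y)%g U -> exists V W : set G,
  [/\ nbhs x V, nbhs y W & forall a b, V a -> W b -> U (a * b)%g].
Proof.
move=> /(@mulg_continuous G (x, y)) [[V W] /= [xV yW] VW].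
by exists V, W; split => // a b Va Wb; apply: (VW (a, b)).
Qed.

Lemma nbhs_invg x U : nbhs (x^-1)%g U -> nbhs x [set y | U (y^-1)%g].
Proof. exact: (@invg_continuous G x). Qed.

Lemma nbhs_mulgl g x U : nbhs (g * x)%g U -> nbhs x [set y | U (g * y)%g].
Proof.
move=> /nbhs_mulg[V [W [gV xW VW]]]; apply: filterS xW => y Wy /=.
by apply: VW => //; apply: nbhs_singleton.
Qed.

Lemma nbhs_mulgr g x U : nbhs (x * g)%g U -> nbhs x [set y | U (y * g)%g].
Proof.
move=> /nbhs_mulg[V [W [xV gW VW]]]; apply: filterS xV => y Vy /=.
by apply: VW => //; apply: nbhs_singleton.
Qed.

Lemma cvg_mulgr (c : nat -> G) x g : c @ \oo --> x ->
  (fun k => c k * g)%g @ \oo --> (x * g)%g.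
Proof. by move=> cx U /nbhs_mulgr /cx. Qed.

Lemma cvg_mulgl (c : nat -> G) x g : c @ \oo --> x ->
  (fun k => g * c k)%g @ \oo --> (g * x)%g.
Proof. by move=> cx U /nbhs_mulgl /cx. Qed.

Lemma locally_finite_mulgr (d : nat -> G) g :
  locally_finite_seq d -> locally_finite_seq (fun k => d k * g)%g.
Proof.
move=> lfd p; have [U pU nU] := lfd (p * g^-1)%g.
exists [set y | U (y * g^-1)%g]; first exact: nbhs_mulgr.
by apply: filterS nU => k nUk /=; rewrite mulgK.
Qed.

Lemma locally_finite_mulgl (d : nat -> G) g :
  locally_finite_seq d -> locally_finite_seq (fun k => g * d k)%g.
Proof.
move=> lfd p; have [U pU nU] := lfd (g^-1 * p)%g.
exists [set y | U (g^-1 * y)%g]; first exact: nbhs_mulgl.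
by apply: filterS nU => k nUk /=; rewrite mulKg.
Qed.

Lemma locally_finite_mulg1 (d w : nat -> G) : w @ \oo --> 1%g ->
  locally_finite_seq d -> locally_finite_seq (fun k => w k * d k)%g.
Proof.
move=> w1 lfd p; have [U pU nU] := lfd p.
have : nbhs (1^-1 * p)%g U by rewrite invg1 mul1g.
move=> /nbhs_mulg[V [W [V1 pW VW]]]; exists W => //.
apply: filterS (filterI nU (w1 _ (nbhs_invg V1))) => k [nUk Vk] Wk.
by apply: nUk; rewrite -(mulKg (w k) (d k)); apply: VW.
Qed.

(** * Words over sequences tending to 1, and tube-free sets *)

Section Sees.
Context (t : nat -> nat -> G) (t1 : forall e, t e @ \oo --> 1%g).

(** The quantifiers are nested: admissible later indices may depend on earlier ones. The head of the
    word is multiplied next to [x]. *)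
Fixpoint sees (s : seq nat) (B : set G) x : Prop :=
  if s is e :: s' then frequently (fun l => sees s' B (t e l * x)%g) else B x.

(** The products by which [sees] moves a point; they tend to 1 as [N] grows. *)
Fixpoint tail_products (s : seq nat) (N : nat) : set G :=
  if s is e :: s' then
    [set w | exists l v, [/\ (N <= l)%N, tail_products s' N v & w = (v * t e l)%g]]
  else [set 1%g].

Lemma seesS s (B C : set G) x : B `<=` C -> sees s B x -> sees s C x.
Proof.
move=> BC; elim: s x => [|e s IH] x /=; first exact: BC.
by apply: frequentlyS => l; apply: IH.
Qed.

Lemma sees_cat s s' B x : sees (s ++ s') B x = sees s (sees s' B) x.
Proof. by elim: s x => //= e s IH x; congr frequently; apply/funext => l. Qed.

Lemma near_mul_t e x U : nbhs x U -> \forall l \near \oo, U (t e l * x)%g.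
Proof. by move=> xU; apply: (cvg_mulgr (g := x) (@t1 e)); rewrite mul1g. Qed.

(** Since each [t e] tends to 1, almost all indices at every letter keep the moved point inside
    [W]. *)
Lemma sees_near s B x W : open W -> W x -> sees s B x -> sees s (B `&` W) x.
Proof.
move=> oW; elim: s x => [|e s IH] x Wx /=; first by split.
move=> fr; have xW : nbhs x W by apply: open_nbhs_nbhs.
apply: frequentlyS (frequently_near fr (near_mul_t e xW)) => l [vl Wl].
exact: IH.
Qed.

Lemma sees_closed s B x : closed B -> sees s B x -> B x.
Proof.
move=> cB; elim: s x => [|e s IH] x //= fr; apply: cB.
apply: (@closure_frequently _ (fun l => t e l * x)%g).
  by move=> U xU; apply: near_mul_t.
by apply: frequentlyS fr => l; apply: IH.
Qed.

Lemma sees_setT s x : sees s setT x.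
Proof. by elim: s x => //= e s IH x; apply: frequently_true. Qed.

(** At each letter infinitely many indices still see [B] and only finitely many see [C], so some
    index beyond [N] does the first and not the second. *)
Lemma sees_diff_tail_products s B C x N : sees s B x -> ~ sees s C x ->
  exists w, [/\ tail_products s N w, B (w * x)%g & ~ C (w * x)%g].
Proof.
elim: s x => [|e s IH] x /=; first by exists 1%g; rewrite mul1g.
move=> fr /not_frequently nfr.
have [l Nl [vB nvC]] := frequently_near fr nfr N.
have [w [pw Bw nCw]] := IH _ vB nvC; exists (w * t e l)%g; rewrite -mulgA.
by split => //; exists l, w.
Qed.

Lemma sees_tail_products s B x N : sees s B x ->
  exists w, tail_products s N w /\ B (w * x)%g.
Proof.
move=> vB; have [|w [pw Bw _]] := @sees_diff_tail_products s B set0 x N vB.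
  by move=> /(sees_closed closed0).
by exists w.
Qed.

Lemma tail_products_near s V : nbhs 1%g V -> \forall N \near \oo, tail_products s N `<=` V.
Proof.
elim: s V => [|e s IH] V V1 /=.
  by apply: filterS filterT => N _ w ->; apply: nbhs_singleton.
move: V1; rewrite -{1}(mulg1 1%g) => /nbhs_mulg[W1 [W2 [/IH W11 W21 WV]]].
have [M _ hM] := @t1 e _ W21.
apply: filterS (filterI W11 (nbhs_infty_ge M)) => N [pN /= MN] w [l [v [Nl pv ->]]].
by apply: WV; [exact: pN|apply: hM => /=; apply: leq_trans Nl].
Qed.

Lemma cvg_tail_products s (w : nat -> G) :
  (forall j, tail_products s j (w j)) -> w @ \oo --> 1%g.
Proof.
move=> pw V V1; apply: filterS (tail_products_near s V1) => j pj; exact: pj (pw j).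
Qed.

Definition tubular (B : set G) (d : nat -> G) : Prop :=
  forall s, frequently (fun k => sees s B (d k)).

Lemma tubularS (B C : set G) d : B `<=` C -> tubular B d -> tubular C d.
Proof. by move=> BC tB s; apply: frequentlyS (tB s) => k; apply: seesS. Qed.

(* Prefixing to all words one word at which C fails moves d off C, while B
   remains tubular. *)
Lemma tubular_refine (P : nat -> set G) d (B C : set G) :
  (forall k, open (P k)) -> (forall k, P k (d k)) ->
  tubular B d -> ~ tubular C d ->
  exists d', [/\ (forall j, exists2 k, (j <= k)%N & P k (d' j)),
    tubular B d' & forall j, ~ C (d' j)].
Proof.
move=> oP Pd tB /existsNP[s /not_frequently nC].
(* Every word recurs infinitely often in [tau], so it suffices that the j-th new point sees [B]
   along [tau j]. *)
have [tau htau] := frequent_enum ([::] : seq nat).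
have [d' hd'] : {d' : nat -> G & forall j, [/\ exists2 k, (j <= k)%N & P k (d' j),
    sees (tau j) B (d' j) & ~ C (d' j)]}.
  apply: (@choice _ _ (fun j y => [/\ exists2 k, (j <= k)%N & P k y,
    sees (tau j) B y & ~ C y])) => j.
  have [k jk [vB nvC]] := frequently_near (tB (s ++ tau j)) nC j.
  move: vB; rewrite sees_cat => /(sees_near (oP k) (Pd k)) vB.
  have [w [_ [vw Pw] nCw]] := sees_diff_tail_products 0 vB nvC.
  by exists (w * d k)%g; split => //; exists k.
exists d'; split => [j|s'|j]; [by have [] := hd' j| |by have [] := hd' j].
by apply: frequentlyS (htau s') => j <-; have [] := hd' j.
Qed.

Definition tube_free (A : set G) : Prop :=
  forall d, locally_finite_seq d -> ~ tubular (closure A) d.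

Lemma tube_freeS (A B : set G) : A `<=` B -> tube_free B -> tube_free A.
Proof. by move=> AB fB d lfd /(tubularS (closureS AB)); apply: fB. Qed.

Lemma tube_free_closure (A : set G) : tube_free A -> tube_free (closure A).
Proof.
by move=> fA d; rewrite -(@closure_id _ (closure A)).1 //; [exact: fA|exact: closed_closure].
Qed.

Lemma tube_free_finite (A : set G) : accessible_space G -> finite_set A -> tube_free A.
Proof.
move=> /accessible_finite_set_closed acc fA d lfd.
rewrite -(closure_id A).1; last exact: acc.
move=> /(_ [::]) /= fr.
by have [k _ []] := frequently_near fr (locally_finite_finite lfd fA) 0.
Qed.

Context (hreg : regular_space G) (g : nat -> G) (hg : forall x, exists n, g n = x).

(** If the closure of the union is tubular around [d], refine [d] to points off [closure A]. The
    complement of [closure A] is open, so these points see [closure B] alone. *)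
Lemma tube_freeU (A B : set G) : tube_free A -> tube_free B -> tube_free (A `|` B).
Proof.
move=> fA fB d lfd tAB; have [P [oP Pd lfP]] := locally_finite_expansion hreg hg lfd.
have [d' [Pd' tAB' nA]] := tubular_refine oP Pd tAB (fA _ lfd).
apply: (fB d' (locally_finite_subordinate lfP Pd')) => s.
apply: frequentlyS (tAB' s) => k.
move=> /(@sees_near _ _ _ (~` closure A)) -/(_ _ (nA k)) h.
apply: seesS (h _); last by apply: closed_openC; exact: closed_closure.
by rewrite closureU => y [[//|]].
Qed.

End Sees.
End Group.

(** * Tameness and relatively compact sets *)

(** Two ways to force a member of every omega-hitting ideal to satisfy [Psi]: one integer suffices,
    as ideals contain the finite sets, or it suffices to hit countably many infinite sets. *)
Definition hitable (Psi : set nat -> Prop) : Prop :=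
  (exists v, forall B : set nat, B v -> Psi B) \/
  (exists F : set (set nat), [/\ countable F, (forall Y, F Y -> infinite_set Y)
    & forall B, (forall Y, F Y -> infinite_set (Y `&` B)) -> Psi B]).

Lemma hitableS (Psi Phi : set nat -> Prop) : (forall B, Psi B -> Phi B) ->
  hitable Psi -> hitable Phi.
Proof.
move=> PP [[v hv]|[F [cF iF hF]]]; [left|right].
  by exists v => B /hv /PP.
by exists F; split => // B /hF /PP.
Qed.

Lemma hitable_mem (Psi : set nat -> Prop) (J : set (set nat)) :
  is_ideal J -> omega_hitting setT J -> hitable Psi -> exists2 B, J B & Psi B.
Proof.
move=> [_ _ Jfin] Jhit [[v hv]|[F [cF iF hF]]].
  by exists [set v]; [exact/Jfin/finite_set1|exact: hv].
have [|B JB hB] := Jhit F cF; first by move=> Y /iF.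
by exists B => //; apply: hF.
Qed.

(** Only the second way combines over countably many conditions: infinitely many prescribed integers
    need not lie in one member of the ideal. *)
Lemma hitable_bigcup (Psi : nat -> set nat -> Prop) :
  (forall k, exists F : set (set nat), [/\ countable F,
    (forall Y, F Y -> infinite_set Y)
    & forall B, (forall Y, F Y -> infinite_set (Y `&` B)) -> Psi k B]) ->
  exists F : set (set nat), [/\ countable F,
    (forall Y, F Y -> infinite_set Y)
    & forall B, (forall Y, F Y -> infinite_set (Y `&` B)) -> forall k, Psi k B].
Proof.
move=> /choice[F hF]; exists (\bigcup_k F k); split.
- by apply: bigcup_countable => // k _; have [] := hF k.
- by move=> Y [k _ FY]; have [_ iF _] := hF k; apply: iF.
- move=> B hB k; have [_ _] := hF k; apply => Y FY; apply: hB.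
  by exists k.
Qed.

(** One of the two ways occurs for infinitely many [k]. If it is the second, the countable families
    are united. If it is the first, the integers either repeat one value infinitely often or form an
    infinite set to be hit. *)
Lemma hitable_frequently (Psi : nat -> set nat -> Prop) :
  frequently (fun k => hitable (Psi k)) ->
  hitable (fun B => frequently (fun k => Psi k B)).
Proof.
move=> /frequently_or[|] fr; last first.
  right; pose Q k := exists F : set (set nat), [/\ countable F,
    (forall Y, F Y -> infinite_set Y)
    & forall B, (forall Y, F Y -> infinite_set (Y `&` B)) -> Psi k B].
  have [|F [cF iF hF]] := @hitable_bigcup (fun k B => Q k -> Psi k B).
    move=> k; have [[F [cF iF hF]]|nQ] := pselect (Q k).
      by exists F; split => // B /hF.
    by exists set0; split.
  exists F; split => // B /hF hB.
  by apply: frequentlyS fr => k Qk; apply: hB.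
pose Q k := exists v, forall B : set nat, B v -> Psi k B.
have [v hv] : {v : nat -> nat & forall k, Q k -> forall B, B (v k) -> Psi k B}.
  apply: (@choice _ _ (fun k v => Q k -> forall B : set nat, B v -> Psi k B)) => k.
  have [[v hv]|nQ] := pselect (Q k); first by exists v.
  by exists 0.
have [[v0 fv0]|nv0] := pselect (exists v0, frequently (fun k => Q k /\ v k = v0)).
  left; exists v0 => B Bv0; apply: frequentlyS fv0 => k [Qk vk].
  by apply: hv => //; rewrite vk.
pose V := [set v k | k in Q].
right; exists [set V]; split => [|Y ->|B /(_ V erefl) iVB].
- exact: countable1.
- apply/infinite_frequently => N.
  have nQ i : \forall k \near \oo, ~ (Q k /\ v k = i).
    by apply: not_frequently => fi; apply: nv0; exists i.
  have [k _ [Qk nk]] := frequently_near fr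
    (@filter_forall_leq _ \oo _ N (fun=> True) _ (fun i _ => nQ i)) 0.
  exists (v k); last by exists k.
  by rewrite leqNgt; apply/negP => /ltnW lt; apply: (nk (v k)).
apply: contrapT => /not_frequently[N _ nP]; apply: iVB.
apply: sub_finite_set (finite_image v (finite_II N)) => _ [[k Qk <-] Bv].
exists k => //=; rewrite ltnNge; apply/negP => Nk.
by apply: (nP k Nk); apply: hv.
Qed.

Lemma closed_under_limits (T : topologicalType) (A : set T) :
  sequential_space T ->
  (forall (c : nat -> T) x, (forall k, A (c k)) -> c @ \oo --> x -> A x) ->
  closed A.
Proof.
move=> hseq hA; apply: contrapT => /hseq[C [x [CA Cx nAx]]].
have [c [_ Cc cx]] := converges_to_seq Cx.
by apply/nAx/(hA c x) => // k; apply/CA/Cc.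
Qed.

(** The points with this property include [Y], and [hitable_frequently] passes it on to limits of
    sequences. *)
Lemma hitable_closure (T : topologicalType) (Y : set T) (f : T -> nat) x :
  sequential_space T -> closure Y x ->
  hitable (fun B => closure (Y `&` f @^-1` B) x).
Proof.
move=> hseq; pose X := [set x | hitable (fun B => closure (Y `&` f @^-1` B) x)].
have cX : closed X.
  apply: closed_under_limits => // c y Xc cy.
  apply: hitableS (hitable_frequently (frequently_true Xc)) => B fr.
  by have := closure_frequently cy fr; rewrite -(closure_id _).1 //; exact: closed_closure.
move=> Yx; apply: cX; apply: closureS Yx => y Yy; left; exists (f y) => B Bf.
exact: subset_closure.
Qed.

(** * Weakly closed ideals and the ideal of relatively compact sets *)

Section Ideals.
Context (G : topologicalGroupType).

(** If almost all of the translate of [C] by [x] lies in [A], then [x] is in [closure A], because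
    [C] tends to 1. *)
Lemma weakly_closed_closure (I : set (set G)) :
  (forall A B, A `<=` B -> I B -> I A) -> (forall A, I A -> I (closure A)) ->
  weakly_closed I.
Proof.
move=> Isub Icl A C C1; split => [IA|]; last by apply: Isub => x; left.
apply: Isub (Icl _ IA) => x [/subset_closure//|fx].
have [c [injc Cc c1]] := converges_to_seq C1.
have cx := cvg_mulgr (g := x) c1; rewrite mul1g in cx.
apply: (closure_frequently cx) => N.
have injcx : injective (fun k => c k * x)%g by move=> i j /mulIg /injc.
have [M _ hM] := injective_tends injcx fx.
exists (maxn N M); rewrite ?leq_maxl//; apply: contrapT => nA.
by apply: (hM (maxn N M)); [exact: leq_maxr|split => //; exists (c (maxn N M))].
Qed.

Definition relatively_compact (A : set G) : Prop :=
  forall y : nat -> G, (forall k, A (y k)) -> ~ locally_finite_seq y.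

Lemma relatively_compact_frequently (A : set G) (y : nat -> G) :
  relatively_compact A -> locally_finite_seq y -> ~ frequently (fun k => A (y k)).
Proof.
move=> cA lfy fr; have [k hk] : {k : nat -> nat & forall i, (i <= k i)%N /\ A (y (k i))}.
  by apply: (@choice _ _ (fun i k => (i <= k)%N /\ A (y k))) => i; have [k] := fr i; exists k.
apply: (cA (y \o k)); first by move=> i; have [] := hk i.
by apply: subseq_locally_finite => // i; have [] := hk i.
Qed.

Lemma relatively_compactS (A B : set G) :
  A `<=` B -> relatively_compact B -> relatively_compact A.
Proof. by move=> AB cB y Ay; apply: cB => k; apply: AB. Qed.

Lemma relatively_compact_ideal : is_ideal relatively_compact.
Proof.
split; first exact: relatively_compactS.
- move=> A B cA cB y ABy lfy.
  by have [] := frequently_or (frequently_true ABy); exact: relatively_compact_frequently.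
- move=> A fA y Ay lfy.
  by have [N _ /(_ N (leqnn N)) []] := locally_finite_finite lfy fA.
Qed.

Lemma relatively_compact_tame : tame relatively_compact.
Proof.
move=> Y /existsNP[y /not_implyP[Yy /contrapT lfy]] f J idJ hitJ.
have hf : hitable (fun B => frequently (fun k => B (f (y k)))).
  apply: hitable_frequently; apply: frequently_true => k.
  by left; exists (f (y k)).
have [B JB fB] := hitable_mem idJ hitJ hf.
exists B => // cB; apply: (relatively_compact_frequently cB lfy).
by apply: frequentlyS fB => k; split.
Qed.

Lemma locally_finite_invg (d : nat -> G) :
  locally_finite_seq d -> locally_finite_seq (fun k => (d k)^-1)%g.
Proof.
move=> lfd p; have [U pU nU] := lfd (p^-1)%g.
exists [set y | U (y^-1)%g]; first exact: nbhs_invg.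
by apply: filterS nU => k nUk /=; rewrite invgK.
Qed.

Lemma relatively_compact_invariant : invariant_ideal relatively_compact.
Proof.
move=> A cA; split=> [g|]; first split.
- move=> y Ay /(locally_finite_mulgl g^-1%g); apply: cA => k.
  by have [a Aa <-] := Ay k; rewrite mulKg.
- move=> y Ay /(locally_finite_mulgr g^-1%g); apply: cA => k.
  by have [a Aa <-] := Ay k; rewrite mulgK.
- move=> y Ay /locally_finite_invg; apply: cA => k.
  by have [a Aa <-] := Ay k; rewrite invgK.
Qed.

Context (hreg : regular_space G) (g : nat -> G) (hg : forall x, exists n, g n = x).

(** A sequence in the closure is replaced by points of [A], one in each set of a locally finite open
    expansion. *)
Lemma relatively_compact_closure (A : set G) :
  relatively_compact A -> relatively_compact (closure A).
Proof.
move=> cA y Ay lfy; have [P [oP Py lfP]] := locally_finite_expansion hreg hg lfy.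
have [z hz] : {z : nat -> G & forall k, A (z k) /\ P k (z k)}.
  apply: (@choice _ _ (fun k z => A z /\ P k z)) => k.
  by have [|z [Az Pz]] := Ay k (P k); [exact: open_nbhs_nbhs|exists z].
apply: (cA z); first by move=> k; have [] := hz k.
apply: (locally_finite_subordinate lfP) => k; exists k => //.
by have [] := hz k.
Qed.

(** A filter on [closure A] without cluster point contains, for each [i], the complement of the
    closure of some neighbourhood [V i] of [g i]. Points of [A] avoiding [V 0], ..., [V k] for
    growing [k] then have no cluster point. *)
Lemma compact_closure (A : set G) : relatively_compact A -> compact (closure A).
Proof.
move=> cA F PF FA; apply: contrapT => /set0P/negP/negPn/eqP nF.
have [V hV] : {V : nat -> set G & forall i, nbhs (g i) (V i) /\ F (~` closure (V i))}.
  apply: (@choice _ _ (fun i V => nbhs (g i) V /\ F (~` closure V))) => i.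
  have [Ag|nAg] := pselect (closure A (g i)).
    have : ~ cluster F (g i) by move=> cF; rewrite -falseE -(in_set0 (g i)) inE -nF.
    move=> /existsNP[B /existsNP[U]] /not_implyP[FB /not_implyP[gU nBU]].
    have [V gV VU] := regular_nbhs hreg gU; exists V; split => //.
    by apply: filterS FB => x Bx /VU Ux; apply: nBU; exists x.
  have [|V gV VU] := @regular_nbhs _ (g i) (~` closure A) hreg.
    by apply: open_nbhs_nbhs; split => //; apply: closed_openC; exact: closed_closure.
  by exists V; split => //; apply: filterS FA => x Ax /VU.
pose W k := [set y | forall i, (i <= k)%N -> True -> (~` closure (V i)) y].
have [y hy] : {y : nat -> G & forall k, A (y k) /\ W k (y k)}.
  apply: (@choice _ _ (fun k y => A y /\ W k y)) => k.
  have FW : F (W k) by apply: filter_forall_leq => i _; have [] := hV i.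
  have [x [Ax Wx]] := filter_ex (filterI FA FW).
  have [|y [Ay Wy]] := Ax (W k); last by exists y.
  have : nbhs x [set y | forall i, (i <= k)%N -> (i <= k)%N -> (~` closure (V i)) y].
    apply: (@filter_forall_leq _ (nbhs x) _ k (fun i => (i <= k)%N)
      (fun i => ~` closure (V i))) => i ik.
    apply: open_nbhs_nbhs; split; first by apply/closed_openC/closed_closure.
    exact: Wx.
  by apply: filterS => z Wz i ik _; apply: Wz.
apply: (cA y) => [k|p]; first by have [] := hy k.
have [i <-] := hg p; exists (V i); first by have [] := hV i.
exists i => // k /= ik Vy; have [_ Wy] := hy k.
by apply: (Wy i) => //; apply: subset_closure.
Qed.

End Ideals.

(** * The axiom applied to the relatively compact sets *)

Section RelativelyCompactAlternative.
Context (G : topologicalGroupType) (hG : tychonoff_space G)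
  (hcount : countable [set: G]) (hseq : sequential_space G)
  (hgroom : groomed G) (hreg : regular_space G).

(** Under (1) the closures of the countable family are compact and determine the topology. Under (2)
    each positive set contains a sequence without cluster points, and a relatively compact [H \ U]
    contains its k-th term for finitely many [k] only. *)
Lemma k_omega_or_countable_locally_finite : IIA ->
  k_omega_space G \/ exists d : nat -> nat -> G,
    (forall m, locally_finite_seq (d m)) /\
    forall U, nbhs 1%g U -> exists m, \forall k \near \oo, U (d m k).
Proof.
have [g _ hg'] := countable_enum 1%g hcount.
have {hg'} hg x : exists n, g n = x by apply: hg'.
have wc : weakly_closed (@relatively_compact G).
  apply: weakly_closed_closure; first exact: relatively_compactS.
  by move=> A; apply: (relatively_compact_closure hreg hg).
move=> /(_ G hG hcount hgroom _ (relatively_compact_ideal G)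
  (relatively_compact_tame (G := G)) wc (relatively_compact_invariant (G := G))).
case=> [[S [cS Sc hS]]|[H [cH Hp hH]]]; [left|right].
  exists [set closure A | A in S]; split.
  - by apply: sub_countable cS; exact: card_image_le.
  - by move=> _ [A SA <-]; apply: (compact_closure hreg hg); apply: Sc.
  - move=> U; split=> [oU _ [A SA <-]|hU].
      by apply/open_subspaceP; exists U => //; rewrite -setIA setIid.
    rewrite -closedC; apply: contrapT => /hseq[C [x [CU Cx /contrapT Ux]]].
    have [A SA iCA] := hS C (ex_intro _ x Cx).
    have clAx : closure A x.
      move=> V xV; have : infinite_set ((C `&` A) `\` (C `\` V)).
        by apply: infinite_setD => //; apply: Cx.2.
      move=> /infinite_setN0[y [[Cy Ay] nCV]]; exists y; split => //.
      by apply: contrapT => nVy; apply: nCV.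
    have /open_subspaceP[V oV VU] := hU (closure A) (ex_intro2 _ _ A SA erefl).
    have Vx : V x.
      have : (V `&` closure A) x by rewrite VU.
      by case.
    apply: iCA; apply: sub_finite_set (Cx.2 V (open_nbhs_nbhs (conj oV Vx))).
    move=> y [Cy Ay]; split => // Vy.
    have : (U `&` closure A `&` closure A) y.
      by rewrite -VU; split => //; apply: subset_closure.
    by move=> [[Uy _] _]; apply: (CU y).
have [H0 HH0 _] := hH setT openT (ex_intro _ 1%g I).
have [u uH Hu] := countable_enum H0 cH.
have {}uH m : H (u m) by case: (uH m) => // ->.
have [d hd] : {d : nat -> nat -> G & forall m,
    (forall k, u m (d m k)) /\ locally_finite_seq (d m)}.
  apply: (@choice _ _ (fun m y => (forall k, u m (y k)) /\ locally_finite_seq y)) => m.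
  by have /existsNP[y /not_implyP[uy /contrapT lfy]] := Hp _ (uH m); exists y.
exists d; split => [m|U U1]; first by have [] := hd m.
have [|A HA cAU] := hH U^° (@open_interior _ U); first by exists 1%g.
have [m uA] := Hu A HA; exists m; have [um lfm] := hd m; subst A.
have := relatively_compact_frequently cAU lfm.
move=> /not_frequently; apply: filterS => k nk; apply: contrapT => nU.
by apply: nk; split => // /interior_subset.
Qed.

End RelativelyCompactAlternative.

(** * The ideal attached to a fan *)

Section TubeIdeal.
Context (G : topologicalGroupType) (hreg : regular_space G)
  (hacc : accessible_space G) (hseq : sequential_space G)
  (g : nat -> G) (hg : forall x, exists n, g n = x).

Section TubeTame.
Context (t : nat -> nat -> G) (t1 : forall e, t e @ \oo --> 1%g).

(** Induction on the word: [hitable_closure] starts it, and each letter costs one use of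
    [hitable_frequently]. *)
Lemma hitable_sees (Y : set G) (f : G -> nat) s x : sees t s (closure Y) x ->
  hitable (fun B => sees t s (closure (Y `&` f @^-1` B)) x).
Proof.
elim: s x => [|e s IH] x /=; first exact: hitable_closure.
by move=> fr; apply: hitable_frequently; apply: frequentlyS fr => l; apply: IH.
Qed.

(** A sequence [y] is built along which each word needs only countably many infinite sets to be hit;
    one member of [J] then serves all words. *)
Lemma tube_free_tame : tame (tube_free t).
Proof.
move=> Y /existsNP[d /not_implyP[lfd /contrapT tY]] f J idJ hitJ.
have [_ _ Jfin] := idJ.
apply: contrapT => noB.
have fB B : J B -> tube_free t (Y `&` f @^-1` B).
  by move=> JB; apply: contrapT => nB; apply: noB; exists B.
have [P [oP Pd lfP]] := locally_finite_expansion hreg hg lfd.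
have [tau htau] := frequent_enum ([::] : seq nat).
pose N v := closure (Y `&` f @^-1` `I_v.+1).
have [y hy] : {y : nat -> G & forall j, [/\ exists2 k, (j <= k)%N & P k (y j),
    sees t (tau j) (closure Y) (y j) & ~ N j (y j)]}.
  apply: (@choice _ _ (fun j y => [/\ exists2 k, (j <= k)%N & P k y,
    sees t (tau j) (closure Y) y & ~ N j y])) => j.
  have [|d' [Pd' tY' nN]] := @tubular_refine _ t t1 P d (closure Y) (N j) oP Pd tY.
    by apply: fB lfd; apply: Jfin; exact: finite_II.
  have [i ji vi] := tY' (tau j) j; exists (d' i); split => //.
  by have [k ik Pk] := Pd' i; exists k => //; apply: leq_trans ik.
have lfy : locally_finite_seq y.
  by apply: locally_finite_subordinate lfP _ => j; have [] := hy j.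
have [|F [cF iF hF]] := @hitable_bigcup (fun q B =>
    frequently (fun k => sees t (tau q) (closure (Y `&` f @^-1` B)) (y k))).
  move=> q; set s := tau q.
  have : hitable (fun B => frequently (fun k => sees t s (closure (Y `&` f @^-1` B)) (y k))).
    apply: hitable_frequently; apply: frequentlyS (htau s) => k <-.
    by apply: hitable_sees; have [] := hy k.
  (* A single integer [v] would, by closedness, put some [y k] with [k >= v] into [N v], hence into
     [N k], which [y k] avoids. *)
  case=> // -[v hv].
  have [k vk] := hv `I_v.+1 (ltnSn v) v.
  move=> /(sees_closed t1 (@closed_closure _ _)) cl.
  have [_ _ nN] := hy k; case: nN.
  by apply: closureS cl => z [Yz /= fz]; split => //=; apply: leq_trans fz _.
have [|B JB hB] := hitJ F cF; first by move=> Z /iF.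
apply: (fB B JB y lfy) => s; have [q _ <-] := htau s 0.
exact: hF.
Qed.

Lemma tube_free_not_determining (S : set (set G)) (d : nat -> nat -> G) :
  countable S -> S `<=` tube_free t ->
  (forall C : set G, (exists x, converges_to C x) ->
     exists2 A, S A & infinite_set (C `&` A)) ->
  (forall m, locally_finite_seq (d m)) ->
  ~ (forall U, nbhs 1%g U -> exists m, \forall k \near \oo, U (d m k)).
Proof.
move=> cS Sf hS lfd hd.
have [u uS Su] := countable_enum set0 cS.
pose N m := [set y | exists2 i, (i <= m)%N & u i y].
have fN m : tube_free t (N m).
  have fu i : tube_free t (u i).
    by have [/Sf//|->] := uS i; apply: tube_free_finite.
  elim: m => [|m IH].
    by apply: tube_freeS (fu 0) => z [i]; rewrite leqn0 => /eqP ->.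
  apply: tube_freeS (tube_freeU t1 hreg hg (fu m.+1) IH) => z [i].
  by rewrite leq_eqVlt => /predU1P[->|im]; [left|right; exists i].
have [w hw] : {w : nat -> nat -> G & forall m, w m @ \oo --> 1%g /\
    \forall k \near \oo, ~ N m (w m k * d m k)%g}.
  apply: (@choice _ _ (fun m w => w @ \oo --> 1%g /\
    \forall k \near \oo, ~ N m (w k * d m k)%g)) => m.
  (* Along the word [s], almost all [d m k] fail to see [closure (N m)], so products along [s] with
     large indices move them off [N m]. *)
  have /existsNP[s /not_frequently nv] := fN m _ (lfd m).
  have [w hw] : {w : nat -> G & forall k, tail_products t s k (w k) /\
      (~ sees t s (closure (N m)) (d m k) -> ~ closure (N m) (w k * d m k)%g)}.
    apply: (@choice _ _ (fun k w => tail_products t s k w /\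
      (~ sees t s (closure (N m)) (d m k) -> ~ closure (N m) (w * d m k)%g))) => k.
    have [v|nvk] := pselect (sees t s (closure (N m)) (d m k)).
      by have [w [pw _]] := sees_tail_products t1 k (sees_setT t s 1%g); exists w; split => // /(_ v).
    have [w [pw _ nw]] := sees_diff_tail_products k (sees_setT t s (d m k)) nvk.
    by exists w; split.
  exists w; split; first by apply: (@cvg_tail_products _ _ t1 s) => k; have [] := hw k.
  by apply: filterS nv => k nvk /subset_closure; have [_] := hw k; exact.
have [M hM] : {M : nat -> nat & forall m k, (M m <= k)%N -> ~ N m (w m k * d m k)%g}.
  apply: (@choice _ _ (fun m M => forall k, (M <= k)%N -> ~ N m (w m k * d m k)%g)) => m.
  by have [_ [M _ nN]] := hw m; exists M.
have lfz m : locally_finite_seq (fun k => w m k * d m k)%g.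
  by apply: locally_finite_mulg1 (lfd m); have [] := hw m.
pose Z m := [set z | exists2 k, (M m <= k)%N & z = (w m k * d m k)%g].
(* Leaving out 1 makes the complement of [ZZ] a neighbourhood of 1; each moved sequence takes the
   value 1 only finitely often. *)
pose ZZ := [set z | z <> 1%g /\ exists m, Z m z].
have cZ : closed ZZ.
  apply: contrapT => /hseq[C [x [CZ Cx _]]].
  have [A SA iCA] := hS C (ex_intro _ x Cx).
  have [i uiA] := Su A SA; subst A.
  (* [Z m] misses [u i] whenever [i <= m], so one of the first [i] sequences contains infinitely
     many points of [C]. *)
  have [m im iC] : exists2 m, (m < i)%N & infinite_set (C `&` u i `&` Z m).
    apply: contrapT => nm; apply: iCA.
    apply: (@sub_finite_set _ _ (\bigcup_(m in `I_i) (C `&` u i `&` Z m))).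
      move=> z [Cz uz]; have [_ [m Zz]] := CZ z Cz; exists m => //=.
      rewrite ltnNge; apply/negP => im; have [k Mk zk] := Zz.
      by apply: (hM m k Mk); rewrite -zk; exists i.
    apply: bigcup_finite; first exact: finite_II.
    by move=> m /= mi; apply: contrapT => im; apply: nm; exists m.
  apply: (@locally_finite_not_converges _ _ (C `&` u i `&` Z m) x (lfz m)).
    by move=> z [_ [k _ ->]]; exists k.
  split => // U xU; apply: sub_finite_set (Cx.2 U xU) => z [[[Cz _] _] nU].
  by split.
have : nbhs (1 * 1)%g (~` ZZ).
  rewrite mulg1; apply: open_nbhs_nbhs; split; first exact: closed_openC.
  by case.
move=> /nbhs_mulg[V [W [V1 W1 VW]]].
have [m dW] := hd W W1.
have [U U1 nU] := lfz m 1%g.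
have [wm1 _] := hw m.
have [k _ [Mk [[Wk Vk] nUk]]] := frequently_near
  (frequently_near (frequently_true (fun k : nat => I)) (nbhs_infty_ge (M m)))
  (filterI (filterI dW (wm1 V V1)) nU) 0.
apply: (VW _ _ Vk Wk); split.
  by move=> wd1; apply: nUk; rewrite wd1; apply: nbhs_singleton.
by exists m; exists k => //; case: Mk.
Qed.

End TubeTame.

(** * The fan closed under conjugation and its ideal *)

Section Fan.
Context (s : nat -> nat -> G) (s1 : forall n, s n @ \oo --> 1%g).

(** The code [e] of a pair (n, m) gives the conjugate of [s n] by [g m]; integers that code no pair
    fall back to (0, 0). *)
Definition conjugates (e l : nat) : G :=
  let p := odflt (0, 0) (unpickle e) in (g p.2 * s p.1 l * (g p.2)^-1)%g.

Lemma conjugatesE n x : exists e, forall l, conjugates e l = (x * s n l * x^-1)%g.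
Proof.
have [m <-] := hg x.
by exists (pickle (n, m)) => l; rewrite /conjugates pickleK.
Qed.

Lemma conjugates_conj e x :
  exists e', forall l, conjugates e' l = (x * conjugates e l * x^-1)%g.
Proof.
set p := odflt (0, 0) (unpickle e).
have [e' he'] := conjugatesE p.1 (x * g p.2)%g; exists e' => l.
by rewrite he' /conjugates -/p invgM !mulgA.
Qed.

Lemma cvg_conjugates e : conjugates e @ \oo --> 1%g.
Proof.
set p := odflt (0, 0) (unpickle e).
have := cvg_mulgr (g := (g p.2)^-1%g) (cvg_mulgl (g := g p.2) (@s1 p.1)).
by rewrite mulg1 mulgV.
Qed.

Let t := conjugates.
Let t1 := cvg_conjugates.

(* Closing the fan under conjugation makes [tube_free] translation invariant;
   invariance under inversion has to be imposed. *)
Definition fan_ideal (A : set G) : Prop :=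
  tube_free t A /\ tube_free t [set x | A (x^-1)%g].

Lemma closure_invg (A : set G) x :
  closure A (x^-1)%g -> closure [set y | A (y^-1)%g] x.
Proof.
move=> Ax U xU; have : nbhs (x^-1)%g [set y | U (y^-1)%g].
  by apply: nbhs_invg; rewrite invgK.
by move=> /Ax[y [Ay Uy]]; exists (y^-1)%g; rewrite /= invgK.
Qed.

(** Right translation commutes with left multiplication along a word, so the words stay the same. *)
Lemma tube_free_mulr (A : set G) h : tube_free t A ->
  tube_free t [set y | A (y * h)%g].
Proof.
move=> fA d /(locally_finite_mulgr h) lfd tA; apply: (fA _ lfd) => r.
have clA y : closure [set y | A (y * h)%g] y -> closure A (y * h)%g.
  by move=> Ay U /nbhs_mulgr /Ay[z [Az Uz]]; exists (z * h)%g.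
apply: frequentlyS (tA r) => k; elim: r (d k) => [|e r IH] x /=; first exact: clA.
by apply: frequentlyS => l /IH; rewrite mulgA.
Qed.

(** Left translation conjugates the letters, so each word is replaced by the word of their
    conjugates by the inverse of [h]. *)
Lemma tube_free_mull (A : set G) h : tube_free t A ->
  tube_free t [set y | A (h * y)%g].
Proof.
move=> fA d /(locally_finite_mulgl h) lfd tA; apply: (fA _ lfd) => r.
have clA y : closure [set y | A (h * y)%g] y -> closure A (h * y)%g.
  by move=> Ay U /nbhs_mulgl /Ay[z [Az Uz]]; exists (h * z)%g.
have [r' hr'] : exists r', forall x, sees t r' (closure [set y | A (h * y)%g]) x ->
    sees t r (closure A) (h * x)%g.
  elim: r => [|e r [r' IH]]; first by exists [::] => x /clA.
  have [e' he'] := conjugates_conj e (h^-1)%g.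
  exists (e' :: r') => x /=; apply: frequentlyS => l /IH.
  by rewrite /t he' invgK !mulgA mulgV mul1g.
by apply: frequentlyS (tA r') => k /hr'.
Qed.

Lemma fan_idealS (A B : set G) : A `<=` B -> fan_ideal B -> fan_ideal A.
Proof.
move=> AB [f1 f2]; split; first exact: tube_freeS f1.
by apply: tube_freeS f2 => x /= /AB.
Qed.

Lemma fan_ideal_is_ideal : is_ideal fan_ideal.
Proof.
split; first exact: fan_idealS.
- move=> A B [fA fA'] [fB fB']; split; first exact: tube_freeU.
  exact: (tube_freeU t1 hreg hg fA' fB').
- move=> A fA; split; first exact: tube_free_finite.
  apply: tube_free_finite => //; apply: (@finite_preimage _ _ A (fun x => x^-1)%g) => //.
  by move=> x y _ _; apply: invg_inj.
Qed.

Lemma fan_ideal_closure (A : set G) : fan_ideal A -> fan_ideal (closure A).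
Proof.
move=> [f1 f2]; split; first exact: tube_free_closure.
by apply: tube_freeS (tube_free_closure f2) => x /= /closure_invg.
Qed.

Lemma fan_ideal_invariant : invariant_ideal fan_ideal.
Proof.
move=> A [f1 f2]; split=> [h|]; first split.
- split.
    by apply: tube_freeS (tube_free_mull (h := (h^-1)%g) f1) => _ [a Aa <-] /=; rewrite mulKg.
  apply: tube_freeS (tube_free_mulr (h := h) f2) => x /= [a Aa hax].
  by rewrite invgM -hax mulKg.
- split.
    by apply: tube_freeS (tube_free_mulr (h := (h^-1)%g) f1) => _ [a Aa <-] /=; rewrite mulgK.
  apply: tube_freeS (tube_free_mull (h := h) f2) => x /= [a Aa hax].
  by rewrite invgM -hax mulgK.
- split.
    by apply: tube_freeS f2 => _ [a Aa <-] /=; rewrite invgK.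
  by apply: tube_freeS f1 => x [a Aa] /invg_inj <-.
Qed.

Lemma fan_ideal_tame : tame fan_ideal.
Proof.
move=> Y nY f J idJ hitJ.
have [nY1|nY2] := (not_andP _ _).1 nY.
  have [B JB nB] := tube_free_tame t1 nY1 f idJ hitJ.
  by exists B => // -[].
have [B JB nB] := tube_free_tame t1 nY2 (f \o (fun x => x^-1)%g) idJ hitJ.
by exists B => // -[].
Qed.

Lemma fan_ideal_weakly_closed : weakly_closed fan_ideal.
Proof.
by apply: weakly_closed_closure; [exact: fan_idealS|exact: fan_ideal_closure].
Qed.

Lemma small_symmetric_nbhs U : nbhs 1%g U -> exists W : set G,
  [/\ open W, W 1%g, (forall x, W x -> W (x^-1)%g) &
    forall a b c, closure W a -> closure W b -> W c -> U (a * b^-1 * c^-1)%g].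
Proof.
move=> U1.
have : nbhs (1 * 1^-1 * 1^-1)%g U by rewrite invg1 !mulg1.
move=> /nbhs_mulg[V1 [V2 [V1n /nbhs_invg V2n V12]]].
have [V3 [V4 [V3n /nbhs_invg V4n V34]]] := nbhs_mulg V1n.
have [V Vn cV] := regular_nbhs hreg (filterI V2n (filterI V3n V4n)).
have cWV : closure (V^° `&` [set x | V^° (x^-1)%g]) `<=` closure V.
  by apply: closureS => x [/interior_subset].
exists (V^° `&` [set x | V^° (x^-1)%g]); split.
- apply: openI; first exact: open_interior.
  rewrite openE => x /= Vx; apply: nbhs_invg; apply: open_nbhs_nbhs.
  by split => //; exact: open_interior.
- by split => //=; rewrite invg1.
- by move=> x [Vx Vx']; split => //=; rewrite invgK.
- move=> a b c /cWV/cV[_ [Va _]] /cWV/cV[_ [_ Vb]] [/interior_subset Vc _].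
  by apply: V12; [apply: V34|have /cV[] := subset_closure Vc].
Qed.

Context (sfan : forall gam : nat -> nat, exists2 U, nbhs 1%g U &
  forall n l, (l <= gam n)%N -> ~ U (s n l)).

Lemma fan_ideal_no_countable_network (H : set (set G)) :
  countable H -> H `<=` ~` fan_ideal ->
  ~ (forall U, open U -> U !=set0 -> exists2 A, H A & fan_ideal (A `\` U)).
Proof.
move=> cH Hn hH.
have [H0 HH0 _] := hH setT openT (ex_intro _ 1%g I).
have [u uH Hu] := countable_enum H0 cH.
have {}uH m : H (u m) by case: (uH m) => // ->.
(* [H' m] is [u m] or its inverse, chosen not to be tube-free; for symmetric [U] both cases behave
   alike. *)
have [H' hH'] : {H' : nat -> set G & forall m, ~ tube_free t (H' m) /\
    forall U, (forall x, U x -> U (x^-1)%g) -> fan_ideal (u m `\` U) ->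
      tube_free t (H' m `\` U)}.
  apply: (@choice _ _ (fun m B => ~ tube_free t B /\
    forall U : set G, (forall x, U x -> U (x^-1)%g) -> fan_ideal (u m `\` U) ->
      tube_free t (B `\` U))) => m.
  have [n1|n2] := (not_andP _ _).1 (Hn _ (uH m)); first by exists (u m); split => // U _ [].
  exists [set x | u m (x^-1)%g]; split => // U symU [_].
  by apply: tube_freeS => x [ux nUx]; split => // /symU; rewrite invgK.
pose X m := closure (H' m).
have [D hD] : {D : nat -> nat -> G & forall m, locally_finite_seq (D m) /\
    tubular t (X m) (D m)}.
  apply: (@choice _ _ (fun m d => locally_finite_seq d /\ tubular t (X m) d)) => m.
  have [/existsNP[d /not_implyP[lfd /contrapT td]] _] := hH' m.
  by exists d.
have [P hP] : {P : nat -> nat -> set G & forall m, [/\ (forall k, open (P m k)),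
    (forall k, P m k (D m k)) & locally_finite_sets (P m)]}.
  apply: (@choice _ _ (fun m P => [/\ (forall k, open (P k)),
    (forall k, P k (D m k)) & locally_finite_sets P])) => m.
  exact: (locally_finite_expansion hreg hg (hD m).1).
have [tau htau] := frequent_enum ([::] : seq nat).
(* [p] pairs the number of a sequence with a word. Stage [j] records an index [k], a product [w]
   along the word and a fan index [l]; [s j l] times [w] moves [D p.1 k] to a point that still sees
   [X p.1] along [tau j]. *)
pose good (p : nat * seq nat) j (q : nat * G * nat) :=
  let y := (s j q.2 * (q.1.2 * D p.1 q.1.1))%g in
  [/\ (j <= q.1.1)%N, tail_products t p.2 j q.1.2, sees t p.2 (X p.1) (D p.1 q.1.1),
      P p.1 q.1.1 y & sees t (tau j) (X p.1) y].
have ex_good p j : exists q, good p j q.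
  case: p => m r; rewrite /good /=.
  have [e he] := conjugatesE j 1%g.
  (* Tubularity is used for [r], then a letter giving [s j] itself, then [tau j]. *)
  have [k jk] := (hD m).2 (r ++ e :: tau j) j; rewrite sees_cat => vk.
  have [oP PD _] := hP m.
  have [w [pw [fr Pw]]] := sees_tail_products t1 j (sees_near t1 (oP k) (PD k) vk).
  have [l _ [vl Pl]] := frequently_near fr (near_mul_t t1 e
    (open_nbhs_nbhs (conj (oP k) Pw))) 0.
  exists (k, w, l); rewrite /= in vl Pl *.
  have sE : t e l = s j l by rewrite /t he invg1 mulg1 mul1g.
  rewrite -sE; split => //; apply: seesS vk.
  by move=> x; apply: (@sees_closed _ _ t1 (e :: tau j)); exact: closed_closure.
have [q hq] : {q : nat * seq nat -> nat -> nat * G * nat & forall p j, good p j (q p j)}.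
  have [q hq] := choice (fun pj : (nat * seq nat) * nat => ex_good pj.1 pj.2).
  by exists (fun p j => q (p, j)) => p j; exact: (hq (p, j)).
(* The pair (m, r) is known only after [U]. The maximum over codes up to [j] bounds, for every
   single pair, almost all recorded fan indices. *)
pose L i j := if unpickle i is Some p then (q p j).2 else 0.
have [U U1 nU] := sfan (fun j => \max_(i < j.+1) L i j).
have [W [oW W1 symW WU]] := small_symmetric_nbhs U1.
have [A HA fA] := hH W oW (ex_intro _ 1%g W1).
have [m uA] := Hu A HA; subst A.
have [_ /(_ W symW fA) fm] := hH' m.
have [lfD tD] := hD m.
have /existsNP[r /not_frequently nv] := fm _ lfD.
pose y j := (s j (q (m, r) j).2 * ((q (m, r) j).1.2 * D m (q (m, r) j).1.1))%g.
have lfy : locally_finite_seq y.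
  have [_ _ lfP] := hP m; apply: (locally_finite_subordinate lfP) => j.
  by have [jk _ _ Py _] := hq (m, r) j; exists (q (m, r) j).1.1.
have XW x : X m x -> ~ closure (H' m `\` W) x -> closure W x.
  move=> Xx nx; have : closure (H' m `\` W `|` W) x.
    by apply: closureS Xx => z Hz; have [Wz|nWz] := pselect (W z); [right|left].
  by rewrite closureU => -[].
apply: (fm y lfy) => r'.
have [M _ nvM] := nv.
apply: frequentlyS (frequently_near (htau r') (filterI (nbhs_infty_ge M)
  (filterI (tail_products_near t1 r (open_nbhs_nbhs (conj oW W1)))
    (nbhs_infty_ge (pickle (m, r)))))) => j [<- [/= Mj [pW pj]]].
have [/= jk pw vX _ vy] := hq (m, r) j.
rewrite -/(y j) in vy.
set k := (q (m, r) j).1.1 in jk vX *.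
(* Arbitrarily small products along [r] move [D m k] into [X m] and off [closure (H' m \ W)], hence
   into [closure W]. *)
have clD : closure W (D m k).
  rewrite (closure_id (closure W)).1; last exact: closed_closure.
  move=> O Ok; have : nbhs 1%g [set w | O (w * D m k)%g].
    by apply: nbhs_mulgr; rewrite mul1g.
  move=> /(tail_products_near t1 r)[N _ /(_ N (leqnn N)) pN].
  have [w [pwN Xw nw]] := sees_diff_tail_products N vX (nvM k (leq_trans Mj jk)).
  by exists (w * D m k)%g; split; [exact: XW|exact: pN].
(* Otherwise cancelling [D m k] and [w] from [y j] would put the recorded point of [s j] into [U],
   although its index is within the bound. *)
have nyW : ~ closure W (y j).
  move=> clW; have /(_ _ (pW _ pw)) := WU _ _ _ clW clD.
  rewrite /y -/k; set w := (q (m, r) j).1.2.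
  rewrite mulgA mulgK mulgK; apply: nU.
  have <- : L (pickle (m, r)) j = (q (m, r) j).2 by rewrite /L pickleK.
  exact: (@leq_bigmax _ (fun i : 'I_j.+1 => L i j) (Ordinal (pj : pickle (m, r) < j.+1)%N)).
have := sees_near t1 (closed_openC (@closed_closure _ W)) nyW vy.
apply: seesS => z [Xz nz]; apply: contrapT => nc.
by apply: nz; apply: XW.
Qed.

End Fan.

End TubeIdeal.

(** * Clopen bases and metrizability *)

Section ClopenBase.
Context (T : topologicalType) (hreg : regular_space T)
  (hacc : accessible_space T) (g : nat -> T) (hg : forall x, exists n, g n = x).

Lemma regular_closed_nbhs (x : T) (A : set T) : closed A -> ~ A x ->
  exists V : set T, [/\ closed V, nbhs x V & V `&` A = set0].
Proof.
move=> cA nAx; have : nbhs x (~` A).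
  by apply: open_nbhs_nbhs; split => //; apply: closed_openC.
move=> /(regular_nbhs hreg)[V xV VA]; exists (closure V); split.
- exact: closed_closure.
- by apply: filterS xV; apply: subset_closure.
- by apply/disjoints_subset.
Qed.

(* Each point g n is added in turn, with a closed neighbourhood, to one of two
   disjoint closed sets. *)
Lemma clopen_nbhs (x : T) (U : set T) : nbhs x U ->
  exists Z : set T, [/\ open Z, closed Z, Z x & Z `<=` U].
Proof.
move=> xU; pose good (p : set T * set T) := [/\ closed p.1, closed p.2 & p.1 `&` p.2 = set0].
have step (np : nat * (set T * set T)) : exists q : set T * set T, good np.2 ->
    [/\ good q, np.2.1 `<=` q.1, np.2.2 `<=` q.2 &
      nbhs (g np.1) q.1 \/ nbhs (g np.1) q.2].
  case: np => n [A B] /=; have [[/= cA cB AB]|ngood] := pselect (good (A, B)); last first.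
    by exists (A, B) => /ngood.
  (* A point of [B] is off [A], so a closed neighbourhood missing [A] is added to [B]; otherwise one
     missing [B] is added to [A]. *)
  have [Bg|nBg] := pselect (B (g n)).
    have nAg : ~ A (g n) by move=> Ag; rewrite -falseE -(in_set0 (g n)) inE -AB.
    have [V [cV gV VA]] := regular_closed_nbhs cA nAg.
    exists (A, B `|` V) => _; split => //=.
    - split => //=; first exact: closedU.
      by rewrite setIUr AB set0U setIC.
    - by right; apply: filterS gV => y; right.
  have [V [cV gV VB]] := regular_closed_nbhs cB nBg.
  exists (A `|` V, B) => _; split => //=.
  - split => //=; first exact: closedU.
    by rewrite setIUl AB set0U.
  - by left; apply: filterS gV => y; right.
have [F hF] := choice step.
pose p := nat_rect (fun=> (set T * set T)%type) ([set x], ~` U^°) (fun n q => F (n, q)).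
have gp n : good (p n).
  elim: n => [|n IH]; last by have [] := hF (n, p n) IH.
  split => /=; first exact: accessible_closed_set1.
    exact/open_closedC/open_interior.
  by apply/disjoints_subset => _ -> /=; apply.
have mono n m : (n <= m)%N -> (p n).1 `<=` (p m).1 /\ (p n).2 `<=` (p m).2.
  elim: m => [|m IH]; first by rewrite leqn0 => /eqP ->; split.
  rewrite leq_eqVlt => /predU1P[->|/IH[s1 s2]]; first by split.
  have [_ s1' s2' _] := hF (m, p m) (gp m).
  by split; [exact: subset_trans s1'|exact: subset_trans s2'].
have dis n m y : (p n).1 y -> (p m).2 y -> False.
  move=> p1 p2; have [_ _ d0] := gp (maxn n m).
  rewrite -falseE -(in_set0 y) inE -d0; split.
    by apply: (mono n _ _).1 p1; exact: leq_maxl.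
  by apply: (mono m _ _).2 p2; exact: leq_maxr.
exists [set y | exists n, (p n).1 y]; split.
- rewrite openE => y [n pny]; have [k ky] := hg y.
  have [_ _ _ []] := hF (k, p k) (gp k); rewrite /= ky.
    by apply: filterS => z pz; exists k.+1.
  by move=> /nbhs_singleton /(dis n k.+1 _ pny).
- rewrite -openC openE => y ny; have [k ky] := hg y.
  have [_ _ _ []] := hF (k, p k) (gp k); rewrite /= ky.
    by move=> /nbhs_singleton pk; case: ny; exists k.+1.
  by apply: filterS => z pz [n pn]; apply: (dis n k.+1 z).
- by exists 0.
- move=> y [n pny]; apply: contrapT => nU; apply: (dis n 0 _ pny) => /=.
  by move=> /interior_subset Uy; apply: nU.
Qed.

End ClopenBase.

(** * Metrizability from a countable clopen base *)

Section Metrizable.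
Context (R : realType) (T : topologicalType) (hacc : accessible_space T)
  (Z : nat -> set T) (oZ : forall i, open (Z i)) (cZ : forall i, closed (Z i))
  (base : forall x U, nbhs x U -> exists i, Z i x /\ Z i `<=` U).

(** The ultrametric is 1/(n+1), with [n] the least index of a base set separating the two points. *)
Lemma metrizable_clopen_base : metrizable_space R T.
Proof.
pose sep i x y := ~ (Z i x <-> Z i y).
have ex_sep x y : x <> y -> exists i, `[< sep i x y >].
  move=> xy; have [|i [Zx ZC]] := @base x (~` [set y]).
    apply: open_nbhs_nbhs; split => //; apply: closed_openC.
    exact: accessible_closed_set1.
  by exists i; apply/asboolP => -[h _]; apply: (ZC _ (h Zx)).
have [nu hnu] : {nu : T * T -> nat & forall p, p.1 <> p.2 ->
    sep (nu p) p.1 p.2 /\ forall j, sep j p.1 p.2 -> (nu p <= j)%N}.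
  apply: (@choice _ _ (fun p n => p.1 <> p.2 ->
    sep n p.1 p.2 /\ forall j, sep j p.1 p.2 -> (n <= j)%N)) => -[x y] /=.
  have [xy|xy] := pselect (x = y); first by exists 0.
  have := ex_minnP (ex_sep x y xy) => -[n /asboolP sn hn].
  by exists n => _; split => // j sj; apply: hn; apply/asboolP.
have sepC i x y : sep i x y -> sep i y x by move=> s [h1 h2]; apply: s.
pose inv (n : nat) : R := (n.+1%:R^-1)%R.
have inv_gt0 n : (0 < inv n)%R by rewrite invr_gt0 ltr0n.
have inv_le n m : (inv n <= inv m)%R = (m <= n)%N.
  by rewrite /inv lef_pV2 ?posrE ?ltr0n// ler_nat ltnS.
pose d x y : R := if `[< x = y >] then 0%R else inv (nu (x, y)).
have dxx x : d x x = 0%R by rewrite /d asboolT.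
have dE x y : x <> y -> d x y = inv (nu (x, y)) by move=> xy; rewrite /d asboolF.
have d0 x y : (0 <= d x y)%R.
  by have [->|xy] := pselect (x = y); [rewrite dxx|rewrite dE // ltW].
exists d; split.
- move=> x y; split => [|-> //].
  have [//|xy] := pselect (x = y); rewrite dE // => e0.
  by have := inv_gt0 (nu (x, y)); rewrite e0 ltxx.
- move=> x y; have [->//|xy] := pselect (x = y).
  have yx : y <> x by move=> /esym.
  rewrite !dE //; congr inv; apply/eqP; rewrite eqn_leq.
  have [/= s1 h1] := hnu (x, y) xy; have [/= s2 h2] := hnu (y, x) yx.
  by rewrite h1 ?h2//; apply: sepC.
- move=> x y z; have [->|xy] := pselect (x = y); first by rewrite dxx add0r.
  have [<-|yz] := pselect (y = z); first by rewrite dxx addr0.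
  have [<-|xz] := pselect (x = z); first by rewrite dxx addr_ge0.
  rewrite !dE //; have [/= s _] := hnu (x, z) xz.
  have [/= _ h1] := hnu (x, y) xy; have [/= _ h2] := hnu (y, z) yz.
  (* A set separating [x] from [z] separates [x] from [y] or [y] from [z]. *)
  have [s1|/contrapT s1] := pselect (sep (nu (x, z)) x y).
    by apply: ler_wpDr; [exact: ltW|rewrite inv_le h1].
  apply: ler_wpDl; first exact: ltW.
  by rewrite inv_le h2 // => s2; apply: s; rewrite s1.
move=> x U; split => [/base[i [Zx ZU]]|[e [e0 eU]]].
  exists (inv i); split => // y /=.
  have [<-|xy] := pselect (x = y); first by move=> _; exact: ZU.
  rewrite dE // ltNge inv_le => /negP n; apply: ZU.
  have [/= _ h] := hnu (x, y) xy.
  have : ~ sep i x y by move=> /h.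
  by move=> /contrapT [+ _]; apply.
have [N hN] : exists N, (inv N < e)%R.
  have [N _ /(_ N (leqnn N))] := near_infty_natSinv_lt (PosNum e0).
  by move=> /= hN; exists N.
apply: filterS eU _.
(* Points on the same side as [x] of the clopen sets [Z 0], ..., [Z N] are at distance at most
   [inv N]. *)
have : nbhs x [set y | forall i, (i <= N)%N -> True -> (Z i x <-> Z i y)].
  apply: (@filter_forall_leq _ (nbhs x) _ N (fun=> True)
    (fun i => [set y | Z i x <-> Z i y])) => i _.
  have [Zx|nZx] := pselect (Z i x).
    by apply: filterS (open_nbhs_nbhs (conj (oZ i) Zx)) => y.
  by apply: filterS (open_nbhs_nbhs (conj (closed_openC (cZ (i := i))) nZx)) => y.
apply: filterS => y hy /=.
have [<-|xy] := pselect (x = y); first by rewrite dxx.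
rewrite dE //; apply: le_lt_trans hN; rewrite inv_le leqNgt; apply/negP => lt.
by have [/= s _] := hnu (x, y) xy; apply: s; apply: hy => //; exact: ltnW.
Qed.

End Metrizable.

(** * Property alpha_4 *)

(** An entangled set contains no convergent sequence, so sequentiality makes all its subsets closed;
    if dense, it is the whole space, which is then discrete. *)
Lemma sequential_groomed (T : topologicalType) (p : T) : accessible_space T ->
  sequential_space T -> ~ open [set p] -> groomed T.
Proof.
move=> hacc hseq np [Y [dY eY]].
have noconv (C : set T) x : C `<=` Y -> ~ converges_to C x.
  move=> CY Cx; have [||A [AY nA]] := eY x [set C]; first exact: countable1.
    by move=> _ ->; split => //; exact: Cx.1.
  move=> /(_ C erefl) iCA; apply: nA => U xU.
  have := infinite_setD iCA (Cx.2 U xU).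
  move=> /infinite_setN0[y [[Cy Ay] nCU]]; exists y; split => //.
  by apply: contrapT => nU; apply: nCU.
have cY A : A `<=` Y -> closed A.
  move=> AY; apply: contrapT => /hseq[C [x [CA Cx _]]].
  by apply: (noconv C x) => //; exact: subset_trans AY.
have YT x : Y x.
  apply: contrapT => nYx.
  have [||y [nYy Yy]] := dY (~` Y); [by exists x| |exact: nYy].
  by apply: closed_openC; apply: cY.
by apply: np; rewrite -closedC; apply: cY => x _; exact: YT.
Qed.

Section Alpha4.
Context (G : topologicalGroupType).

Lemma cvg_mulg (a b : nat -> G) (x y : G) : a @ \oo --> x -> b @ \oo --> y ->
  (fun k => a k * b k)%g @ \oo --> (x * y)%g.
Proof.
move=> ax byy U /nbhs_mulg[V [W [xV yW VW]]].
have aV : \forall k \near \oo, V (a k) by exact: ax.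
have bW : \forall k \near \oo, W (b k) by exact: byy.
by apply: filterS (filterI aV bW) => k [Vk Wk]; apply: VW.
Qed.

(** The condition [i <= n i] ensures that infinitely many of the sequences are met. *)
Definition alpha4 : Prop := forall s : nat -> nat -> G,
  (forall n, s n @ \oo --> 1%g) ->
  exists n k : nat -> nat, (forall i, i <= n i)%N /\
    (fun i => s (n i) (k i)) @ \oo --> 1%g.

Lemma cvg_index_ge (a : nat -> G) (n : nat -> nat) (x : G) : (forall i, i <= n i)%N ->
  a @ \oo --> x -> a \o n @ \oo --> x.
Proof.
move=> ni ax U /ax[N _ hN]; exists N => // i /= Ni.
by apply: hN => /=; apply: leq_trans (ni i).
Qed.

Context (hacc : accessible_space G) (hreg : regular_space G)
  (hseq : sequential_space G) (g : nat -> G) (hg : forall x, exists n, g n = x).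

(** A counterexample to [alpha4] is trimmed: an initial block including every sequence through 1 is
    dropped, and each remaining sequence is cut to a tail. Initial pieces of the result then form a
    closed set, whose complement is the required neighbourhood. *)
Lemma not_alpha4_fan : ~ alpha4 -> exists s : nat -> nat -> G,
  (forall n, s n @ \oo --> 1%g) /\
  forall gam : nat -> nat, exists2 U, nbhs 1%g U &
    forall n l, (l <= gam n)%N -> ~ U (s n l).
Proof.
move=> /existsNP[s /not_implyP[s1 nos]].
have {}nos (n k : nat -> nat) : (forall i, i <= n i)%N ->
    ~ (fun i => s (n i) (k i)) @ \oo --> 1%g.
  by move=> ni c; apply: nos; exists n, k.
have [n0 _ sn1] : \forall n \near \oo, ~ exists l, s n l = 1%g.
  apply: not_frequently => fr.
  have [nk hnk] : {nk : nat -> nat * nat & forall i, (i <= (nk i).1)%N /\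
      s (nk i).1 (nk i).2 = 1%g}.
    apply: (@choice _ _ (fun i (p : nat * nat) => (i <= p.1)%N /\ s p.1 p.2 = 1%g)) => i.
    by have [n ni [l snl]] := fr i; exists (n, l).
  apply: (nos (fun i => (nk i).1) (fun i => (nk i).2)) => [i|U U1].
    by have [] := hnk i.
  exists 0 => // i _ /=; have [_ ->] := hnk i.
  exact: nbhs_singleton.
(* [closure (U i)] misses [g i]; after trimming, only 1 can be the limit of points taken from ever
   later sequences. *)
have [U hU] : {U : nat -> set G & forall i, nbhs 1%g (U i) /\
    (g i <> 1%g -> ~ closure (U i) (g i))}.
  apply: (@choice _ _ (fun i U => nbhs 1%g U /\
    (g i <> 1%g -> ~ closure U (g i)))) => i.
  have [->|gi1] := pselect (g i = 1%g); first by exists setT; split => //; exact: filterT.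
  have : nbhs 1%g (~` [set g i]).
    apply: open_nbhs_nbhs; split; last by move=> /esym.
    by apply/closed_openC/accessible_closed_set1.
  move=> /(regular_nbhs hreg)[V V1 cV]; exists V; split => // _ /cV.
  exact.
have [m hm] : {m : nat -> nat & forall n l, (m n <= l)%N ->
    forall i, (i <= n)%N -> U i (s (n0 + n) l)}.
  apply: (@choice _ _ (fun n m => forall l, (m <= l)%N ->
    forall i, (i <= n)%N -> U i (s (n0 + n) l))) => n.
  have U1 : nbhs 1%g [set y | forall i, (i <= n)%N -> True -> U i y].
    by apply: filter_forall_leq => i _; have [] := hU i.
  have [M _ hM] := s1 (n0 + n) _ U1; exists M => l Ml i iN.
  exact: (hM l Ml i iN).
pose s' n l := s (n0 + n) (m n + l).
have s'1 n : s' n @ \oo --> 1%g.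
  apply: (@cvg_index_ge (s (n0 + n)) (fun l => m n + l)%N) => // i.
  exact: leq_addl.
exists s'; split => // gam.
pose F := [set y | exists n l, (l <= gam n)%N /\ y = s' n l].
have cF : closed F.
  apply: contrapT => /hseq[C [x [CF /converges_to_seq[c [injc Cc cx]] _]]].
  have [nl hnl] : {nl : nat -> nat * nat & forall i, ((nl i).2 <= gam (nl i).1)%N /\
      c i = s' (nl i).1 (nl i).2}.
    apply: (@choice _ _ (fun i (p : nat * nat) => (p.2 <= gam p.1)%N /\ c i = s' p.1 p.2)) => i.
    by have [n [l [lg ci]]] := CF _ (Cc i); exists (n, l).
  (* Each sequence contributes finitely many points to [F], so the injective [c] runs through ever
     later sequences. *)
  have nlN N : \forall i \near \oo, (N <= (nl i).1)%N.
    have fin : finite_set (\bigcup_(n in `I_N) (s' n @` `I_(gam n).+1)).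
      by apply: bigcup_finite => [|n _]; [|apply: finite_image]; exact: finite_II.
    apply: filterS (injective_tends injc fin) => i nF.
    rewrite leqNgt; apply/negP => lt; apply: nF; have [lg ->] := hnl i.
    by exists (nl i).1 => //; exists (nl i).2.
  have x1 : x = 1%g.
    have [j gx] := hg x; apply: contrapT => nx1; rewrite -gx in cx nx1.
    apply: (hU j).2 => //; apply: closure_frequently cx _ => N.
    have [M _ hM] := nlN j; exists (maxn N M); first exact: leq_maxl.
    have [_ ->] := hnl (maxn N M); apply: hm; first exact: leq_addr.
    by apply: hM => /=; exact: leq_maxr.
  rewrite x1 in cx.
  have [I_ hI] : {I_ : nat -> nat & forall i, (i <= I_ i)%N /\ (i <= (nl (I_ i)).1)%N}.
    apply: (@choice _ _ (fun i j => (i <= j)%N /\ (i <= (nl j).1)%N)) => i.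
    have [M _ hM] := nlN i; exists (maxn i M); split; first exact: leq_maxl.
    by apply: hM => /=; exact: leq_maxr.
  have := cvg_index_ge (fun i => (hI i).1) cx.
  rewrite (_ : c \o I_ = fun i => s (n0 + (nl (I_ i)).1) (m (nl (I_ i)).1 + (nl (I_ i)).2)).
    apply: nos => i; apply: leq_trans (hI i).2 _; exact: leq_addl.
  by apply/funext => i /=; have [_ ->] := hnl (I_ i).
exists (~` F); last by move=> n l lg nF; apply: nF; exists n, l.
apply: open_nbhs_nbhs; split; first exact: closed_openC.
move=> [n [l [_ s1']]]; apply: (sn1 (n0 + n)); first exact: leq_addr.
by exists (m n + l).
Qed.

(** The limits of sequences in [A] are closed under limits: the approximating sequences are
    translated to 1, where [alpha4] selects a diagonal. *)
Lemma alpha4_frechet (A : set G) x : alpha4 -> closure A x ->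
  exists2 c : nat -> G, (forall k, A (c k)) & c @ \oo --> x.
Proof.
move=> h4; pose X : set G := [set x : G | exists2 c : nat -> G, (forall k, A (c k)) & c @ \oo --> x].
have cX : closed X.
  apply: closed_under_limits => // a y Xa ay.
  have [c hc] : {c : nat -> nat -> G & forall n, (forall k, A (c n k)) /\ c n @ \oo --> a n}.
    apply: (@choice _ _ (fun n c => (forall k, A (c k)) /\ c @ \oo --> a n)) => n.
    by have [c] := Xa n; exists c.
  have [|n [k [ni nk1]]] := h4 (fun n k => (a n)^-1 * c n k)%g.
    by move=> n; have := cvg_mulgl (g := (a n)^-1%g) (hc n).2; rewrite mulVg.
  exists (fun i => c (n i) (k i)); first by move=> i; apply: (hc _).1.
  have := cvg_mulg (cvg_index_ge ni ay) nk1; rewrite mulg1.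
  by under eq_fun do rewrite /= mulVKg.
move=> Ax; apply: cX; apply: closureS Ax => y Ay.
by exists (fun=> y) => //; exact: cvg_cst.
Qed.

End Alpha4.

(** * Nowhere dense sets *)

Definition nowhere_dense_set (T : topologicalType) (A : set T) : Prop :=
  forall U, open U -> U !=set0 ->
    exists V, [/\ open V, V !=set0, V `<=` U & V `<=` ~` A].

Section NowhereDense.
Context (T : topologicalType).

Lemma nowhere_dense_setS (A B : set T) :
  A `<=` B -> nowhere_dense_set B -> nowhere_dense_set A.
Proof.
move=> AB nB U oU U0; have [V [oV V0 VU VB]] := nB U oU U0.
by exists V; split => // y /VB nBy /AB.
Qed.

Lemma nowhere_dense_setU (A B : set T) : nowhere_dense_set A ->
  nowhere_dense_set B -> nowhere_dense_set (A `|` B).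
Proof.
move=> nA nB U oU U0; have [V [oV V0 VU VA]] := nA U oU U0.
have [W [oW W0 WV WB]] := nB V oV V0.
exists W; split => //; first exact: subset_trans VU.
by move=> y Wy [Ay|By]; [apply: (VA y) => //; exact: WV|exact: (WB y)].
Qed.

Lemma nowhere_dense_closure (A : set T) :
  nowhere_dense_set A -> nowhere_dense_set (closure A).
Proof.
move=> nA U oU U0; have [V [oV V0 VU VA]] := nA U oU U0.
exists V; split => // y Vy /(_ V (open_nbhs_nbhs (conj oV Vy)))[z [Az Vz]].
exact: (VA z).
Qed.

Lemma nowhere_dense_finite (A : set T) : accessible_space T ->
  (forall x : T, ~ open [set x]) -> finite_set A -> nowhere_dense_set A.
Proof.
move=> hacc nopen /finite_seqP[s ->].
elim: s => [|x s IH] => [U oU U0|]; first by exists U; split.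
have -> : [set` x :: s] = [set x] `|` [set` s].
  by apply/seteqP; split => y /=; rewrite inE => /predU1P.
apply: nowhere_dense_setU => // U oU U0; exists (U `\` [set x]); split.
- by apply: openI => //; apply/closed_openC/accessible_closed_set1.
- apply: contrapT => /set0P/negP/negPn/eqP UX; apply: (nopen x).
  rewrite (_ : [set x] = U) //; apply/seteqP; split => y.
    move=> ->; have [z Uz] := U0; have [<-//|zx] := pselect (z = x).
    by have : (U `\` [set x]) z by []; rewrite UX.
  move=> Uy; apply: contrapT => yx.
  by have : (U `\` [set x]) y by []; rewrite UX.
- by move=> y [].
- by move=> y [].
Qed.

Lemma nowhere_dense_preimage (A : set T) (phi psi : T -> T) :
  continuous phi -> continuous psi -> cancel phi psi -> cancel psi phi ->
  nowhere_dense_set A -> nowhere_dense_set (psi @^-1` A).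
Proof.
move=> /continuousP cphi /continuousP cpsi phiK psiK nA U oU [u Uu].
have [|V [oV [v Vv] VU VA]] := nA _ (cphi _ oU).
  by exists (psi u); rewrite /= psiK.
exists (psi @^-1` V); split; first exact: cpsi.
- by exists (phi v); rewrite /= phiK.
- by move=> y /VU /=; rewrite psiK.
- by move=> y /VA.
Qed.

End NowhereDense.

(** * The axiom applied to the nowhere dense sets *)

Section NowhereDenseIdeal.
Context (G : topologicalGroupType) (hacc : accessible_space G)
  (hreg : regular_space G) (hseq : sequential_space G)
  (g : nat -> G) (hg : forall x, exists n, g n = x)
  (h4 : alpha4 G) (nopen1 : ~ open [set 1%g : G]).

Lemma continuous_mulgl (h : G) : continuous (fun x => h * x)%g.
Proof. by move=> x U /nbhs_mulgl. Qed.

Lemma continuous_mulgr (h : G) : continuous (fun x => x * h)%g.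
Proof. by move=> x U /nbhs_mulgr. Qed.

Lemma not_open_singleton (x : G) : ~ open [set x].
Proof.
move=> ox; apply: nopen1.
have /continuousP/(_ _ ox) := @continuous_mulgl x.
suff -> : (fun y : G => x * y)%g @^-1` [set x] = [set 1%g] by [].
apply/seteqP; split => y /=; last by move=> ->; rewrite mulg1.
by move=> xy; apply: (mulgI x); rewrite mulg1.
Qed.

Lemma nowhere_dense_ideal : is_ideal (@nowhere_dense_set G).
Proof.
split; [exact: nowhere_dense_setS|exact: nowhere_dense_setU|].
by move=> A; apply: nowhere_dense_finite => //; exact: not_open_singleton.
Qed.

Lemma nowhere_dense_invariant : invariant_ideal (@nowhere_dense_set G).
Proof.
move=> A nA; split=> [h|]; first split.
- apply: nowhere_dense_setS (nowhere_dense_preimage (continuous_mulgl (h := h))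
    (continuous_mulgl (h := h^-1%g)) (mulKg h) (mulVKg h) nA).
  by move=> _ [a Aa <-] /=; rewrite mulKg.
- apply: nowhere_dense_setS (nowhere_dense_preimage (continuous_mulgr (h := h))
    (continuous_mulgr (h := h^-1%g)) (mulgK h) (mulgVK h) nA).
  by move=> _ [a Aa <-] /=; rewrite mulgK.
- apply: nowhere_dense_setS (nowhere_dense_preimage (@invg_continuous G)
    (@invg_continuous G) (@invgK G) (@invgK G) nA).
  by move=> _ [a Aa <-] /=; rewrite invgK.
Qed.

Lemma alpha4_tail_sequence (A : nat -> set G) x : (forall n, closure (A n) x) ->
  exists (n : nat -> nat) (y : nat -> G), [/\ (forall i, i <= n i)%N,
    (forall i, A (n i) (y i)) & y @ \oo --> x].
Proof.
move=> Ax; have [c hc] : {c : nat -> nat -> G & forall n,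
    (forall k, A n (c n k)) /\ c n @ \oo --> x}.
  apply: (@choice _ _ (fun n c => (forall k, A n (c k)) /\ c @ \oo --> x)) => n.
  by have [c] := alpha4_frechet hseq h4 (Ax n); exists c.
have [|n [k [ni nk1]]] := h4 (s := fun n k => (x^-1 * c n k)%g).
  by move=> n; have := cvg_mulgl (g := (x^-1)%g) (hc n).2; rewrite mulVg.
exists n, (fun i => c (n i) (k i)); split => //; first by move=> i; exact: (hc _).1.
have := cvg_mulgl (g := x) nk1; rewrite mulg1.
by under eq_fun do rewrite mulVKg.
Qed.

(** [Y] is dense in some open [U]. If no member of [J] worked, the points of [Y] with [f] large
    would accumulate at each point of [U], excluding the single-integer way; as the group is
    countable, one member of [J] then has a preimage dense in [U]. *)
Lemma nowhere_dense_tame : tame (@nowhere_dense_set G).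
Proof.
move=> Y /existsNP[U /not_implyP[oU /not_implyP[U0 nV]]] f J idJ hitJ.
have [_ _ Jfin] := idJ.
have YV V : open V -> V !=set0 -> V `<=` U -> exists y, V y /\ Y y.
  move=> oV V0 VU; apply: contrapT => nVY; apply: nV; exists V; split => //.
  by move=> y Vy Yy; apply: nVY; exists y.
apply: contrapT => noB.
have nB B : J B -> nowhere_dense_set (Y `&` f @^-1` B).
  by move=> JB; apply: contrapT => n; apply: noB; exists B.
have Uhit x : U x -> exists F : set (set nat), [/\ countable F,
    (forall Z, F Z -> infinite_set Z) & forall B,
    (forall Z, F Z -> infinite_set (Z `&` B)) -> closure (Y `&` f @^-1` B) x].
  move=> Ux.
  have clY n : closure (Y `&` [set y | (n <= f y)%N]) x.
    move=> O; rewrite nbhsE => -[Q [oQ Qx] QO].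
    have [|V [oV V0 VO nVY]] := nB _ (Jfin _ (finite_II n)) (Q `&` U) (openI oQ oU).
      by exists x.
    have [|z [Vz Yz]] := YV V oV V0; first by move=> z /VO[].
    exists z; split; last by apply: QO; have [] := VO z Vz.
    split => //=; rewrite leqNgt; apply/negP => fz.
    by apply: (nVY z Vz).
  have [n [y [ni Yy yx]]] := alpha4_tail_sequence clY.
  have hit : hitable (fun B => frequently (fun i => B (f (y i)))).
    apply: hitable_frequently; apply: frequently_true => i.
    by left; exists (f (y i)).
  case: hit => [[v hv]|[F [cF iF hF]]].
    have [i vi /= fy] := hv [set v] erefl v.+1.
    have [_ /= nf] := Yy i.
    by have := leq_trans (ni i) nf; rewrite fy leqNgt vi.
  exists F; split => // B /hF fr; apply: closure_frequently yx _.
  by apply: frequentlyS fr => i Bf; split => //; have [] := Yy i.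
have [|F [cF iF hF]] := @hitable_bigcup
    (fun k B => U (g k) -> closure (Y `&` f @^-1` B) (g k)).
  move=> k; have [Uk|nUk] := pselect (U (g k)); last by exists set0; split.
  by have [F [cF iF hF]] := Uhit _ Uk; exists F; split => // B /hF.
have [|B JB hB] := hitJ F cF; first by move=> Z /iF.
have [V [oV [v Vv] VU VB]] := nB B JB U oU U0.
have [k gk] := hg v; have := hF B hB k; rewrite gk.
move=> /(_ (VU v Vv) V (open_nbhs_nbhs (conj oV Vv)))[z [Yz Vz]].
exact: (VB z).
Qed.

Lemma nowhere_dense_weakly_closed : weakly_closed (@nowhere_dense_set G).
Proof.
by apply: weakly_closed_closure; [exact: nowhere_dense_setS|exact: nowhere_dense_closure].
Qed.

(** The complements of the [N m] all accumulate at 1, so [alpha4] gives a sequence tending to 1 that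
    meets each [u j] in a finite set. *)
Lemma nowhere_dense_not_determining (S : set (set G)) : countable S ->
  S `<=` @nowhere_dense_set G ->
  ~ (forall C : set G, (exists x, converges_to C x) ->
       exists2 A, S A & infinite_set (C `&` A)).
Proof.
move=> cS Sn hS; have [u uS Su] := countable_enum set0 cS.
have [_ _ nfin] := nowhere_dense_ideal.
have nu i : nowhere_dense_set (u i) by have [/Sn//|->] := uS i; apply: nfin.
(* Including 1 keeps it off the sequence chosen below, whose range is therefore infinite. *)
pose N m := [set y | y = 1%g \/ exists2 i, (i <= m)%N & u i y].
have nN m : nowhere_dense_set (N m).
  have n1 : nowhere_dense_set [set 1%g : G] by apply: nfin.
  elim: m => [|m IH].
    apply: nowhere_dense_setS (nowhere_dense_setU n1 (nu 0)) => y [->|[i]].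
      by left.
    by rewrite leqn0 => /eqP ->; right.
  apply: nowhere_dense_setS (nowhere_dense_setU (nu m.+1) IH) => y [->|[i]].
    by right; left.
  by rewrite leq_eqVlt => /predU1P[->|im]; [left|right; right; exists i].
have clN n : closure (~` N n) 1%g.
  move=> O; rewrite nbhsE => -[Q [oQ Q1] QO].
  have [|V [oV [v Vv] VO VN]] := nN n Q oQ; first by exists 1%g.
  by exists v; split; [exact: VN|apply/QO/VO].
have [n [y [ni Ny y1]]] := alpha4_tail_sequence clN.
pose C := range y.
have C1 : converges_to C 1%g.
  split => [fC|U U1].
    have : nbhs 1%g (~` C).
      apply: open_nbhs_nbhs; split.
        by apply: closed_openC; apply: (accessible_finite_set_closed.1 hacc).
      by move=> [i _ yi]; apply: (Ny i); left.
    by move=> /y1[M _ /(_ M (leqnn M))]; apply; exists M.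
  have [M _ hM] := y1 U U1.
  apply: sub_finite_set (finite_image y (finite_II M)) => _ [[i _ <-] nUi].
  by exists i => //=; rewrite ltnNge; apply/negP => Mi; apply/nUi/hM.
have [A SA iCA] := hS C (ex_intro _ 1%g C1).
have [j ujA] := Su A SA; subst A; apply: iCA.
apply: sub_finite_set (finite_image y (finite_II j)) => _ [[i _ <-] uy].
exists i => //=; rewrite ltnNge; apply/negP => ji; apply: (Ny i); right.
by exists j => //; apply: leq_trans (ni i).
Qed.

(** [u m] is dense in the open set [Q m], so [Q m] lies in [closure W] once [u m \ W] is nowhere
    dense. The base consists of the [Q m] translated by the inverses of their points [q m]. *)
Lemma nowhere_dense_network_base (H : set (set G)) : countable H ->
  H `<=` positive_sets (@nowhere_dense_set G) ->
  (forall U, open U -> U !=set0 -> exists2 A, H A & nowhere_dense_set (A `\` U)) ->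
  exists B : nat -> set G, (forall m, nbhs 1%g (B m)) /\
    forall V, nbhs 1%g V -> exists m, B m `<=` V.
Proof.
move=> cH Hn hH.
have [H0 HH0 _] := hH setT openT (ex_intro _ 1%g I).
have [u uH Hu] := countable_enum H0 cH.
have {}uH m : H (u m) by case: (uH m) => // ->.
have [Q hQ] : {Q : nat -> set G & forall m, [/\ open (Q m), Q m !=set0 &
    forall V, open V -> V !=set0 -> V `<=` Q m -> exists y, V y /\ u m y]}.
  apply: (@choice _ _ (fun m Q => [/\ open Q, Q !=set0 &
    forall V, open V -> V !=set0 -> V `<=` Q -> exists y, V y /\ u m y])) => m.
  have /existsNP[U /not_implyP[oU /not_implyP[U0 nV]]] := Hn _ (uH m).
  exists U; split => // V oV V0 VU; apply: contrapT => nVu; apply: nV.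
  by exists V; split => // y Vy uy; apply: nVu; exists y.
have [q hq] : {q : nat -> G & forall m, Q m (q m)}.
  by apply: (@choice _ _ (fun m x => Q m x)) => m; have [_ [x]] := hQ m; exists x.
exists (fun m => [set x | Q m (x * q m)%g]); split => [m|V V1].
  by apply: nbhs_mulgr; rewrite mul1g; apply: open_nbhs_nbhs; split => //; have [] := hQ m.
have [W [oW W1 symW WV]] := small_symmetric_nbhs hreg V1.
have [A HA nA] := hH W oW (ex_intro _ 1%g W1).
have [m umA] := Hu A HA; subst A; exists m => x /= Ox.
have OcW z : Q m z -> closure W z.
  move=> Oz; apply: contrapT => nWz.
  have [oQ _ Omeet] := hQ m.
  have oOW : open (Q m `\` closure W).
    by apply: openI => //; apply/closed_openC/closed_closure.
  have [|V2 [oV2 V20 V2O V2u]] := nA _ oOW; first by exists z.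
  have [|y [Vy uy]] := Omeet V2 oV2 V20; first by move=> y /V2O[].
  apply: (V2u y Vy); split => // Wy; have [_] := V2O y Vy; apply.
  exact: subset_closure.
have := WV _ _ 1%g (OcW _ Ox) (OcW _ (hq m)) W1.
by rewrite invg1 mulg1 mulgK.
Qed.

End NowhereDenseIdeal.

(** * Metrizability of first countable groups and the dichotomy *)

Lemma first_countable_metrizable (R : realType) (G : topologicalGroupType)
    (g : nat -> G) (B : nat -> set G) :
  accessible_space G -> regular_space G -> (forall x, exists n, g n = x) ->
  (forall m, nbhs 1%g (B m)) ->
  (forall V : set G, nbhs 1%g V -> exists m, B m `<=` V) -> metrizable_space R G.
Proof.
move=> hacc hreg hg B1 Bbase.
(* [Z (n, m)] is a clopen set around [g n] inside the translate of [B m] to [g n]; these sets form a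
   countable base. *)
have [Z hZ] : {Z : nat * nat -> set G & forall p, [/\ open (Z p), closed (Z p),
    Z p (g p.1) & Z p `<=` [set y | B p.2 (y * (g p.1)^-1)%g]]}.
  apply: (@choice _ _ (fun p Z => [/\ open Z, closed Z,
    Z (g p.1) & Z `<=` [set y | B p.2 (y * (g p.1)^-1)%g]])) => p.
  apply: (clopen_nbhs hreg hacc hg); apply: nbhs_mulgr; rewrite mulgV.
  exact: B1.
apply: (@metrizable_clopen_base R G hacc (fun i => Z (odflt (0, 0) (unpickle i)))).
- by move=> i; have [] := hZ (odflt (0, 0) (unpickle i)).
- by move=> i; have [] := hZ (odflt (0, 0) (unpickle i)).
move=> x U xU; have [n gx] := hg x; subst x.
have [|m BU] := Bbase [set y | U (y * g n)%g].
  by apply: nbhs_mulgr; rewrite mul1g.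
exists (pickle (n, m)); rewrite pickleK /=.
have [_ _ Zg ZB] := hZ (n, m); split => // y /ZB /BU /=.
by rewrite mulgVK.
Qed.

Theorem theorem19 (R : realType) (hIIA : IIA) (G : topologicalGroupType)
    (hG : tychonoff_space G) (hcount : countable [set: G])
    (hseq : sequential_space G) :
  metrizable_space R G \/ k_omega_space G.
Proof.
have [hacc hcr] := hG.
have hreg : regular_space G by exact: (@completely_regular_regular R).
have [g _ hg'] := countable_enum 1%g hcount.
have {hg'} hg x : exists n, g n = x by apply: hg'.
(* The discrete case is treated apart: groomedness and the ideal of nowhere dense sets are obtained
   for 1 not isolated. *)
have [open1|nopen1] := pselect (open [set 1%g : G]).
  left; apply: (@first_countable_metrizable R G g (fun=> [set 1%g])) => // [_|V V1].
    exact: open_nbhs_nbhs.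
  by exists 0 => _ ->; apply: nbhs_singleton.
have hgr := sequential_groomed hacc hseq nopen1.
have [h4|n4] := pselect (alpha4 G).
  left; have := hIIA G hG hcount hgr _ (nowhere_dense_ideal hacc nopen1)
    (nowhere_dense_tame hseq hg h4) (@nowhere_dense_weakly_closed G)
    (@nowhere_dense_invariant G).
  case=> [[S [cS Sn hS]]|[H [cH Hn hH]]].
    by case: (nowhere_dense_not_determining hacc hseq h4 nopen1 cS Sn hS).
  have [B [B1 Bbase]] := nowhere_dense_network_base hreg cH Hn hH.
  exact: (@first_countable_metrizable R G g B).
right; have [//|[d [lfd hd]]] :=
  k_omega_or_countable_locally_finite hG hcount hseq hgr hreg hIIA.
have [s [s1 sfan]] := not_alpha4_fan hacc hreg hseq hg n4.
have := hIIA G hG hcount hgr _ (fan_ideal_is_ideal hreg hacc hg s1)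
  (fan_ideal_tame hreg hseq hg s1) (@fan_ideal_weakly_closed G g s)
  (@fan_ideal_invariant G g hg s).
case=> [[S [cS Sn hS]]|[H [cH Hn hH]]].
  case: (tube_free_not_determining hreg hacc hseq hg (cvg_conjugates g s1)
    cS _ hS lfd hd).
  by move=> A /Sn[].
by case: (fan_ideal_no_countable_network hreg hg s1 sfan cH Hn hH).
Qed.
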